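(* Let $\varphi:(M^3,g)\to(N^2,h)$ be a $C^\infty$ semi-conformal submersion with dilation $\lambda$. Then the Ricci tensor of $(M,g)$ is given by $$\mathrm{Ricci}(g)=\left\{\lambda^2K^N+\Delta\ln\lambda+\mu(\ln\lambda)\right\}(g-\theta^2)-\tfrac14\|I\|^2g+\tfrac12\mathcal L_\mu g-(\mu^\flat+d^{\mathcal V}\ln\lambda)^2-(d^{\mathcal V}\ln\lambda)^2+2\,d(U(\ln\lambda))\odot\theta+d^*\Omega\odot\theta,$$ where $\mu$ denotes the mean curvature vector field of the fibres of $\varphi$ and $K^N$ is the Gauss curvature of $N$ (evaluated at $\varphi(x)$).
   Context: A smooth submersion $\varphi:(M^3,g)\to(N^2,h)$ is semi-conformal with dilation $\lambda:M\to(0,\infty)$ if $\varphi^*h(X,Y)=\lambda^2g(X,Y)$ for all $X,Y\in\mathcal H$, where $\mathcal V=\ker d\varphi$ (vertical) and $\mathcal H=\mathcal V^\perp$ (horizontal); $\mathcal V,\mathcal H$ also denote the orthogonal projections. $U$ is a chosen unit vertical vector field (if it does not exist globally, work locally; the formula does not depend on the choice), $\theta=g(U,\cdot)$, $\Omega=d\theta$, with $d\theta(X,Y)=X\theta(Y)-Y\theta(X)-\theta([X,Y])$. $I(X,Y)=\mathcal V[X,Y]$ for $X,Y\in\mathcal H$, and $\|I\|^2=\sum_{a,b}|I(e_a,e_b)|^2$ over all pairs from an orthonormal frame $\{e_1,e_2\}$ of $\mathcal H$. $\mu=\nabla_UU$, $\mu^\flat=g(\mu,\cdot)$. $d^{\mathcal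 V}f=U(f)\theta$. $\omega\odot\eta=\frac12(\omega\otimes\eta+\eta\otimes\omega)$, $\omega^2=\omega\otimes\omega$. $\Delta=\mathrm{Tr}\nabla d$ on $(M,g)$; $d^*\Omega(X)=-\sum_i(\nabla_{e_i}\Omega)(e_i,X)$ for an orthonormal frame $\{e_i\}$ of $TM$. *)

(* Defs.v *)
From mathcomp Require Import all_boot all_order all_algebra.
From mathcomp Require Import all_classical all_reals all_analysis.

Set Implicit Arguments.
Unset Strict Implicit.
Unset Printing Implicit Defensive.

Import Order.TTheory GRing.Theory Num.Theory.
Import numFieldNormedType.Exports.

Local Open Scope classical_set_scope.
Local Open Scope ring_scope.

Definition pderive (R : realType) (n : nat) (V : normedModType R) (i : 'I_n)
  (f : 'rV[R]_n -> V) : 'rV[R]_n -> V := fun x => 'D_(delta_mx 0 i) f x.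

(* C^oo: all iterated partial derivatives exist and are (Frechet)
   differentiable at the points of A, which is an open set in every use below. *)
Definition smooth_on (R : realType) (n : nat) (V : normedModType R)
  (A : set 'rV[R]_n) (f : 'rV[R]_n -> V) : Prop :=
  forall (s : seq 'I_n) (x : 'rV[R]_n), A x ->
    differentiable (foldr (fun i h => pderive i h) f s) x.

(* chart_inv is the inverse of chart_map on the open set chart_map @` chart_dom;
   outside of this set its values are irrelevant. *)
Record chart (R : realType) (n : nat) (T : topologicalType) := Chart {
  chart_dom : set T;
  chart_map : T -> 'rV[R]_n;
  chart_inv : 'rV[R]_n -> T;
  chart_dom_open : open chart_dom;
  chart_cod_open : open (chart_map @` chart_dom);
  chart_mapK : forall p, chart_dom p -> chart_inv (chart_map p) = p;
  chart_map_continuous : {within chart_dom, continuous chart_map};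
  chart_inv_continuous : {within chart_map @` chart_dom, continuous chart_inv} }.

Record manifold (R : realType) (n : nat) := Manifold {
  points :> topologicalType;
  charts : Type;
  chart_of : charts -> chart R n points;
  manifold_hausdorff : hausdorff_space points;
  manifold_second_countable : @second_countable points;
  charts_cover : forall p : points, exists c : charts, chart_dom (chart_of c) p;
  charts_compatible : forall c d : charts,
    smooth_on (chart_map (chart_of c) @`
                 (chart_dom (chart_of c) `&` chart_dom (chart_of d)))
      (chart_map (chart_of d) \o chart_inv (chart_of c)) }.

Coercion chart_of : charts >-> chart.

Section SmoothMaps.
Context (R : realType) (m n : nat) (M : manifold R m) (N : manifold R n).

Definition rep (phi : M -> N) (c : charts M) (d : charts N) :
  'rV[R]_m -> 'rV[R]_n := chart_map d \o phi \o chart_inv c.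

Definition smooth_map (phi : M -> N) : Prop :=
  continuous phi /\
  forall (c : charts M) (d : charts N),
    smooth_on (chart_map c @` (chart_dom c `&` phi @^-1` chart_dom d))
      (rep phi c d).

Definition tangent_map (phi : M -> N) (c : charts M) (d : charts N) (p : M) :
  'rV[R]_m -> 'rV[R]_n := 'd (rep phi c d) (chart_map c p).

Definition submersion (phi : M -> N) : Prop :=
  smooth_map phi /\
  forall (p : M) (c : charts M) (d : charts N),
    chart_dom c p -> chart_dom d (phi p) ->
    forall w : 'rV[R]_n, exists v : 'rV[R]_m, tangent_map phi c d p v = w.

End SmoothMaps.

(* A tensor field is given by its components in every chart, as functions of
   the coordinates; the components of a tangent vector at p in two charts c, d
   correspond through tangent_map id c d p. *)

Definition ip (R : realType) (n : nat) (B : 'M[R]_n) (v w : 'rV[R]_n) : R :=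
  (v *m B *m w^T) 0 0.

Record riemannian (R : realType) (n : nat) (M : manifold R n) := Riemannian {
  gram :> charts M -> 'rV[R]_n -> 'M[R]_n;
  gram_sym : forall (c : charts M) (p : M), chart_dom c p ->
    (gram c (chart_map c p))^T = gram c (chart_map c p);
  gram_pos : forall (c : charts M) (p : M), chart_dom c p ->
    forall v : 'rV[R]_n, v != 0 -> 0 < ip (gram c (chart_map c p)) v v;
  gram_law : forall (c d : charts M) (p : M), chart_dom c p -> chart_dom d p ->
    forall v w : 'rV[R]_n,
    ip (gram c (chart_map c p)) v w =
    ip (gram d (chart_map d p)) (tangent_map (fun q : M => q) c d p v)
                                (tangent_map (fun q : M => q) c d p w);
  gram_smooth : forall c : charts M,
    smooth_on (chart_map c @` chart_dom c) (gram c) }.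

Record vector_field (R : realType) (n : nat) (M : manifold R n) (W : set M) :=
  VectorField {
  vf_comp :> charts M -> 'rV[R]_n -> 'rV[R]_n;
  vf_law : forall (c d : charts M) (p : M),
    W p -> chart_dom c p -> chart_dom d p ->
    vf_comp d (chart_map d p) =
    tangent_map (fun q : M => q) c d p (vf_comp c (chart_map c p));
  vf_smooth : forall c : charts M,
    smooth_on (chart_map c @` (chart_dom c `&` W)) (vf_comp c) }.

(* In what follows, G is the Gram matrix of the metric in the coordinates of a
   chart. Tensors are evaluated on vectors v at x by applying their defining
   formula to vector fields extending v; since the result does not depend on
   the extension, the one with constant components, cst v, is used. *)

Section LocalGeometry.
Context (R : realType) (n : nat).
Implicit Types (G : 'rV[R]_n -> 'M[R]_n) (X Y Z : 'rV[R]_n -> 'rV[R]_n)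
  (x v w z : 'rV[R]_n) (f : 'rV[R]_n -> R).

Definition orthonormal_family (I : finType) (B : 'M[R]_n) (e : I -> 'rV[R]_n) : Prop :=
  forall i j : I, ip B (e i) (e j) = (i == j)%:R.

Definition bracket X Y x : 'rV[R]_n := 'D_(X x) Y x - 'D_(Y x) X x.

Definition christoffel G x (i j k : 'I_n) : R :=
  2^-1 * \sum_(l < n) invmx (G x) k l *
    (pderive i (fun y => G y j l) x + pderive j (fun y => G y i l) x
     - pderive l (fun y => G y i j) x).

(* Levi-Civita connection: nabla_v Y at x *)
Definition nabla G v Y x : 'rV[R]_n :=
  'D_v Y x + \row_k \sum_(i < n) \sum_(j < n)
               christoffel G x i j k * v 0 i * Y x 0 j.

(* R(X, Y) Z = [nabla_X, nabla_Y] Z - nabla_[X, Y] Z *)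
Definition curvature G X Y Z x : 'rV[R]_n :=
  nabla G (X x) (fun y => nabla G (Y y) Z y) x
  - nabla G (Y x) (fun y => nabla G (X y) Z y) x
  - nabla G (bracket X Y x) Z x.

(* trace of z |-> R(z, v) w *)
Definition ricci G x v w : R :=
  \sum_(k < n) curvature G (cst (delta_mx 0 k)) (cst v) (cst w) x 0 k.

Definition sectional G x v w : R :=
  ip (G x) (curvature G (cst v) (cst w) (cst w) x) v
  / (ip (G x) v v * ip (G x) w w - ip (G x) v w ^+ 2).

Definition hessian G f x v w : R :=
  'D_v (fun y => 'D_w f y) x - 'D_(nabla G v (cst w) x) f x.

(* e is meant to be an orthonormal basis of (R^n, G x) *)
Definition laplacian G (e : 'I_n -> 'rV[R]_n) f x : R :=
  \sum_(i < n) hessian G f x (e i) (e i).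

Definition flat G X x v : R := ip (G x) (X x) v.

Definition ext_deriv1 (theta : 'rV[R]_n -> 'rV[R]_n -> R) X Y x : R :=
  'D_(X x) (fun y => theta y (Y y)) x - 'D_(Y x) (fun y => theta y (X y)) x
  - theta x (bracket X Y x).

Definition nabla_form2 G (Omega : 'rV[R]_n -> 'rV[R]_n -> 'rV[R]_n -> R)
  x z v w : R :=
  'D_z (fun y => Omega y v w) x - Omega x (nabla G z (cst v) x) w
  - Omega x v (nabla G z (cst w) x).

(* e as in laplacian *)
Definition codiff2 G (e : 'I_n -> 'rV[R]_n)
  (Omega : 'rV[R]_n -> 'rV[R]_n -> 'rV[R]_n -> R) x v : R :=
  - \sum_(i < n) nabla_form2 G Omega x (e i) (e i) v.

Definition lie_metric G Z x v w : R :=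
  'D_(Z x) (fun y => ip (G y) v w) x - ip (G x) (bracket Z (cst v) x) w
  - ip (G x) v (bracket Z (cst w) x).

(* the mean curvature of the integral curves of a unit field u: nabla_u u *)
Definition mean_curv G u x : 'rV[R]_n := nabla G (u x) u x.

(* For a unit field u: the orthogonal projection onto the line spanned by u. *)
Definition vproj G u x v : 'rV[R]_n := flat G u x v *: u x.

Definition hproj G u x v : 'rV[R]_n := v - vproj G u x v.

(* For horizontal v, w: the vertical part of [X, Y] for horizontal fields X, Y
   extending v, w. *)
Definition integrability G u x v w : 'rV[R]_n :=
  vproj G u x (bracket (fun y => hproj G u y v) (fun y => hproj G u y w) x).

(* e is meant to be an orthonormal basis of the horizontal space at x *)
Definition normI2 G u (I : finType) (e : I -> 'rV[R]_n) x : R :=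
  \sum_(a : I) \sum_(b : I)
    ip (G x) (integrability G u x (e a) (e b)) (integrability G u x (e a) (e b)).

(* Omega = d theta for theta = flat G u *)
Definition domega G u x v w : R := ext_deriv1 (flat G u) (cst v) (cst w) x.

(* d^V f = u(f) theta *)
Definition dvert G u f x v : R := 'D_(u x) f x * flat G u x v.

End LocalGeometry.

Definition gauss_curvature (R : realType) (G : 'rV[R]_2 -> 'M[R]_2)
  (x : 'rV[R]_2) : R := sectional G x (delta_mx 0 0) (delta_mx 0 1).

Definition symprod (R : realType) (V : Type) (a b : V -> R) (v w : V) : R :=
  2^-1 * (a v * b w + b v * a w).

Section SemiConformal.
Context (R : realType) (m n : nat) (M : manifold R m) (N : manifold R n).

(* The vertical space at p is the kernel of F = d phi_p, and B is the metric. *)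
Definition horizontal (B : 'M[R]_m) (F : 'rV[R]_m -> 'rV[R]_n) (v : 'rV[R]_m)
  : Prop := forall w : 'rV[R]_m, F w = 0 -> ip B v w = 0.

Definition semiconformal (g : riemannian M) (h : riemannian N) (phi : M -> N)
  (lambda : M -> R) : Prop :=
  (forall p : M, 0 < lambda p) /\
  forall (p : M) (c : charts M) (d : charts N),
    chart_dom c p -> chart_dom d (phi p) ->
    let F := tangent_map phi c d p in
    let B := g c (chart_map c p) in
    forall v w : 'rV[R]_m, horizontal B F v -> horizontal B F w ->
    ip (h d (chart_map d (phi p))) (F v) (F w) = lambda p ^+ 2 * ip B v w.

Definition unit_vertical (g : riemannian M) (phi : M -> N) (W : set M)
  (U : vector_field W) : Prop :=
  forall (p : M) (c : charts M) (d : charts N),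
    W p -> chart_dom c p -> chart_dom d (phi p) ->
    tangent_map phi c d p (U c (chart_map c p)) = 0 /\
    ip (g c (chart_map c p)) (U c (chart_map c p)) (U c (chart_map c p)) = 1.

End SemiConformal.

(* Main.v *)
(** In a chart around [p], the smooth functions form a commutative ring with
    commuting derivations, and connection, curvature, Hessian etc. are algebraic
    expressions over this ring. Horizontal lifts of an orthonormal frame of [N],
    multiplied by [lambda] and completed by the unit vertical field [u], form an
    orthonormal frame [e0], [e1], [u] of [M] with
      [e0, e1] = p e0 + q e1 + 2w u,  [u, ei] = u(ln lambda) ei + b_i u,
    where [p + e1(ln lambda)] and [q - e0(ln lambda)] are [lambda] times pullbacks
    of the structure functions of the frame of [N], which also determine [K^N].
    The Koszul formula gives the connection, and in this frame each component of
    the formula follows from the Jacobi identity, the commutators acting on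
    [ln lambda], and the constancy of the pulled back functions along the fibres.
    Both sides being tensors, the formula then holds for all [X] and [Y]. *)

(* With the analytic definitions each step would carry its own differentiability argument; over a
   ring with commuting derivations the steps become equations open to [ring]. The price is paid
   once: mixed partial derivatives must commute, and inverses, square roots and logarithms must stay
   smooth, because the frame, [lam] and [l = ln lam] have to be elements of the ring. Factors of 2
   are cleared on the way: the Koszul formula gives twice the connection, the vertical part of
   [e0, e1] is called 2w, and the identity is shown for twice the Ricci tensor. In these terms
   ||I||^2 = 2 (2w)^2. Of the Jacobi identity the vertical component on e0, e1, u is used. It gives
   u(w), which occurs with opposite signs in the components (e0, e1) and (e1, e0) of the Ricci
   tensor, whereas the right-hand side is visibly symmetric. *)
From HB Require Import structures.
From mathcomp Require Import all_boot all_order all_algebra.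
From mathcomp Require Import all_classical all_reals all_analysis.
From mathcomp Require Import ring lra.
Require Import Defs.

Set Implicit Arguments.
Unset Strict Implicit.
Unset Printing Implicit Defensive.

Import Order.TTheory GRing.Theory Num.Theory.
Import numFieldNormedType.Exports.

Local Open Scope classical_set_scope.
Local Open Scope ring_scope.

(** * Symmetry of second derivatives *)

Section Schwarz.
Context (R : realType) (V : normedModType R).
Implicit Types (f : V -> R) (a v w : V).

(** Restriction to a line makes the one-variable mean value theorem available for directional
    derivatives. *)
Lemma is_derive_line f a v (t : R) : differentiable f (a + t *: v) ->
  is_derive t 1 (fun s : R => f (a + s *: v)) ('D_v f (a + t *: v)).
Proof.
move=> df.
have dl : is_diff t (fun s : R => a + s *: v) ( *:%R ^~ v).
  have -> : (fun s : R => a + s *: v) = cst a + ( *:%R ^~ v) by [].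
  by apply: is_diff_eq; rewrite add0r.
have dc := is_diff_comp dl (differentiableP df).
have -> : (fun s : R => f (a + s *: v)) = f \o (fun s : R => a + s *: v) by [].
apply: DeriveDef; first exact/diff_derivable/ex_diff.
by rewrite deriveE ?diff_val /= ?scale1r ?deriveE//; exact: ex_diff.
Qed.

Lemma differentiable_approx f a (e : R) : 0 < e -> differentiable f a ->
  \forall h \near 0, `|f (a + h) - (f a + 'd f a h)| <= e * `|h|.
Proof.
move=> e0 /diff_locally/eqaddoP/(_ _ e0); apply: filterS => h.
by rewrite [a + h]addrC.
Qed.

(** The second difference is the increment over [0, t] of [g s = f (a + t w + s v) - f (a + s v)].
    The mean value theorem turns it into [dg c * t], and differentiability of ['D_v f] at [a]
    expands [dg c] to first order. *)
Lemma second_difference_approx f a v w (e : R) : 0 < e ->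
  (\forall y \near a, differentiable f y) -> differentiable ('D_v f) a ->
  \forall t \near 0^'+,
    `|f (a + t *: w + t *: v) - f (a + t *: v) - (f (a + t *: w) - f a)
      - t ^+ 2 * 'D_w ('D_v f) a| <= e * t ^+ 2.
Proof.
move=> e0 df ddf.
(* The two remainders, at [k c true] and [k c false], add up to at most e / K times t (2 |v| + |w|);
   the summand 1 keeps [K] positive. *)
set K : R := 2 * `|v| + `|w| + 1.
have K0 : 0 < K by rewrite /K; have := normr_ge0 v; have := normr_ge0 w; lra.
have eK0 : 0 < e / K by rewrite divr_gt0.
have df0 := (nbhs0P _ _).1 df.
have near0 : \forall h \near (0 : V), differentiable f (a + h) /\
    `|'D_v f (a + h) - ('D_v f a + 'd ('D_v f) a h)| <= e / K * `|h|.
  by apply: filterI => //; exact: differentiable_approx.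
have [d /= d0 hd] := (nbhs_ballP _ _).1 near0.
have dK0 : 0 < d / K by rewrite divr_gt0.
near=> t.
have t0 : 0 < t by [].
have td : t * K < d by rewrite -ltr_pdivlMr//; near: t; exact: nbhs_right_lt.
pose k (s : R) (b : bool) := s *: v + (if b then t *: w else 0).
have small (s : R) (b : bool) : 0 <= s <= t ->
    `|k s b| <= t * (`|v| + (if b then `|w| else 0)).
  move=> /andP[s0 st]; rewrite (le_trans (ler_normD _ _))// mulrDr lerD//.
    by rewrite normrZ ger0_norm// ler_wpM2r.
  by case: b; rewrite ?normr0 ?mulr0// normrZ gtr0_norm.
have inball (s : R) (b : bool) : 0 <= s <= t -> ball 0 d (k s b).
  move=> /small -/(_ b) h; rewrite -ball_normE/= sub0r normrN.
  apply: (le_lt_trans h) => {h}; apply: le_lt_trans td; rewrite ler_pM2l// /K.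
  by have := normr_ge0 v; have := normr_ge0 w; case: b; lra.
have ak1 s : a + t *: w + s *: v = a + k s true by rewrite /k addrAC addrA.
have ak0 s : a + s *: v = a + k s false by rewrite /k addr0.
pose g (s : R) := f (a + t *: w + s *: v) - f (a + s *: v).
pose dg (s : R) := 'D_v f (a + t *: w + s *: v) - 'D_v f (a + s *: v).
have gd (s : R) : 0 <= s <= t -> is_derive s 1 g (dg s).
  move=> hs; apply: is_deriveB; apply: is_derive_line.
    by rewrite ak1; exact: (hd _ (inball _ _ hs)).1.
  by rewrite ak0; exact: (hd _ (inball _ _ hs)).1.
have [||c /[!in_itv]/= /andP[c0 ct]] := @MVT R g dg 0 t t0.
- by move=> s /[!in_itv]/= /andP[s0 st]; apply: gd; rewrite !ltW.
- apply: derivable_within_continuous => s /[!in_itv]/= hs.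
  by have [] := gd s hs.
rewrite subr0 /g !scale0r !addr0 => ->.
have hc : 0 <= c <= t by rewrite !ltW.
have := (hd _ (inball c true hc)).2; have := (hd _ (inball c false hc)).2.
have := small c true hc; have := small c false hc.
rewrite -ak0 -ak1 addr0 /dg (deriveE w ddf).
have -> : 'd ('D_v f) a (k c true) = 'd ('D_v f) a (k c false) + t * 'd ('D_v f) a w.
  by rewrite /k addr0 linearD; congr (_ + _); rewrite linearZ.
move: ('d _ _ w) ('d _ _ _) (`|k c true|) (`|k c false|) => L L' n1 n2.
move: ('D_v f (_ + _ + _)) ('D_v f (a + _)) ('D_v f a) => f1 f2 f3 hn2 hn1 h2 h1.
have -> : (f1 - f2) * t - t ^+ 2 * L
  = ((f1 - (f3 + (L' + t * L))) - (f2 - (f3 + L'))) * t by ring.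
rewrite normrM (gtr0_norm t0) expr2 mulrA ler_pM2r//.
rewrite (le_trans (ler_normB _ _))// (le_trans (lerD h1 h2))// -mulrDr.
rewrite -mulrA ler_pM2l// ler_pdivrMl//.
rewrite (le_trans (lerD hn1 hn2))// -mulrDr [K * t]mulrC ler_pM2l// /K.
by lra.
Unshelve. all: by end_near. Qed.

(** The second difference is symmetric in [v] and [w], so after division by t^2 both mixed
    derivatives are limits of the same quotient. *)
Lemma derive_comm f a v w : (\forall y \near a, differentiable f y) ->
  differentiable ('D_v f) a -> differentiable ('D_w f) a ->
  'D_w ('D_v f) a = 'D_v ('D_w f) a.
Proof.
move=> df dv dw; apply/eqP; rewrite -subr_eq0 -normr_le0.
apply/ler_addgt0Pl => e e0; rewrite addr0.
have e20 : 0 < e / 2 by rewrite divr_gt0.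
have N1 := second_difference_approx w e20 df dv.
have N2 := second_difference_approx v e20 df dw.
have [t [t0 [h1 h2]]] := filter_ex (filterI (nbhs_right_gt (0 : R)) (filterI N1 N2)).
have t20 : 0 < t ^+ 2 by rewrite exprn_gt0.
rewrite -(ler_pM2r t20) -[X in _ * X <= _](gtr0_norm t20) -normrM.
move: h1 h2; rewrite [a + _ + t *: w]addrAC.
move: (f (_ + _ + _)) (f (a + t *: v)) (f (a + t *: w)) (f a).
move: ('D_w _ _) ('D_v _ _) => x y f1 f2 f3 f4 h1 h2.
have -> : (x - y) * t ^+ 2 = (f1 - f3 - (f2 - f4) - t ^+ 2 * y)
  - (f1 - f2 - (f3 - f4) - t ^+ 2 * x) by ring.
by rewrite (le_trans (ler_normB _ _))// (le_trans (lerD h2 h1))// -mulrDl -splitr.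
Qed.

End Schwarz.

(** * Smooth functions on an open set *)

Lemma near_eq_differentiable (R : realType) (V W : normedModType R) (f g : V -> W) x :
  (\near x, f x = g x) -> differentiable f x -> differentiable g x.
Proof.
move=> fg df.
have fgx : f x = g x := nbhs_singleton fg.
have dfc : continuous ('d f x) by exact: diff_continuous.
have ho : g \o shift x = cst (g x) + 'd f x +o_ 0 id.
  apply/eqaddoP => e e0; have := (eqaddoP _ _ _ _).1 (diff_locally df) e e0.
  have fg0 := (nbhs0P _ _).1 fg.
  apply: filterS2 fg0 => h fgh.
  rewrite -[(f \o shift x - _) h]/(f (h + x) - (f x + 'd f x h)).
  rewrite -[(g \o shift x - _) h]/(g (h + x) - (g x + 'd f x h)).
  by rewrite [h + x]addrC fgh fgx.
by apply/diff_locallyP; rewrite (diff_unique dfc ho).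
Qed.

Section SmoothOn.
Context (R : realType) (n : nat) (D : set 'rV[R]_n) (oD : open D).

(** A grading of [smooth_on] by order, made for induction on [k]. Derivatives up to order [k] are
    asked to be differentiable, so that order 0 means differentiability. *)
Definition Ck_on (V : normedModType R) (k : nat) (f : 'rV[R]_n -> V) : Prop :=
  forall s : seq 'I_n, (size s <= k)%N -> forall x, D x ->
  differentiable (foldr (fun i h => pderive i h) f s) x.

Lemma smooth_onP (V : normedModType R) (f : 'rV[R]_n -> V) :
  smooth_on D f <-> forall k, Ck_on k f.
Proof.
split=> [fs k s _ x|fk s x]; first exact: fs.
by move=> Dx; exact: (fk (size s)).
Qed.

(** The derivative split off is the innermost one, that is, the last entry of the list of
    indices. *)
Lemma Ck_onS (V : normedModType R) k (f : 'rV[R]_n -> V) :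
  Ck_on k.+1 f <->
  (forall x, D x -> differentiable f x) /\ forall i, Ck_on k (pderive i f).
Proof.
split=> [fk|[f0 fk] s].
  split=> [x Dx|i s sk x Dx]; first exact: (fk [::]).
  by have := fk (rcons s i); rewrite foldr_rcons size_rcons; exact.
case/lastP: s => [_ x Dx|s i]; first exact: f0.
by rewrite size_rcons foldr_rcons => sk; exact: fk.
Qed.

Lemma Ck_on_differentiable (V : normedModType R) k (f : 'rV[R]_n -> V) x :
  Ck_on k f -> D x -> differentiable f x.
Proof. by move=> fk; exact: (fk [::]). Qed.

Lemma smooth_on_differentiable (V : normedModType R) (f : 'rV[R]_n -> V) x :
  smooth_on D f -> D x -> differentiable f x.
Proof. by move=> fk; exact: (fk [::]). Qed.

Lemma smooth_on_pderive (V : normedModType R) (f : 'rV[R]_n -> V) i :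
  smooth_on D f -> smooth_on D (pderive i f).
Proof. by move=> fs s x Dx; have := fs (rcons s i) x Dx; rewrite foldr_rcons. Qed.

Lemma near_on (T : Type) (f g : 'rV[R]_n -> T) x :
  (forall y, D y -> f y = g y) -> D x -> \near x, f x = g x.
Proof. by move=> fg Dx; apply: filterS (open_nbhs_nbhs (conj oD Dx)). Qed.

Lemma derive_on (V : normedModType R) (f g : 'rV[R]_n -> V) x v :
  (forall y, D y -> f y = g y) -> D x -> 'D_v f x = 'D_v g x.
Proof. by move=> fg Dx; apply: near_eq_derive; exact: near_on. Qed.

(** Since [D] is open, derivatives at its points see only values in [D]. This allows a derivative to
    be replaced by a formula that is valid on [D] alone. *)
Lemma Ck_on_eq (V : normedModType R) k (f g : 'rV[R]_n -> V) :
  (forall y, D y -> f y = g y) -> Ck_on k f -> Ck_on k g.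
Proof.
elim: k f g => [|k IH] f g fg.
  move=> fk [|//] _ x Dx; apply: (near_eq_differentiable (near_on fg Dx)).
  exact: (fk [::]).
move=> /Ck_onS[df fk]; apply/Ck_onS; split.
  by move=> x Dx; apply: (near_eq_differentiable (near_on fg Dx)); exact: df.
by move=> i; apply: IH (fk i) => y Dy; exact: derive_on.
Qed.

Lemma pderiveD (f g : 'rV[R]_n -> R) i x : differentiable f x -> differentiable g x ->
  pderive i (f + g) x = pderive i f x + pderive i g x.
Proof. by move=> df dg; rewrite /pderive deriveD//; exact: diff_derivable. Qed.

Lemma pderiveM (f g : 'rV[R]_n -> R) i x : differentiable f x -> differentiable g x ->
  pderive i (f * g) x = f x * pderive i g x + g x * pderive i f x.
Proof. by move=> df dg; rewrite /pderive deriveM//; exact: diff_derivable. Qed.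

Lemma Ck_on_cst k (a : R) : Ck_on k (cst a : 'rV[R]_n -> R).
Proof.
elim: k a => [|k IH] a; first by case=> // _ x _; exact: differentiable_cst.
apply/Ck_onS; split=> [x _|i]; first exact: differentiable_cst.
by apply: (Ck_on_eq (f := cst 0)) => // y _; rewrite /pderive derive_cst.
Qed.

Lemma Ck_onD k (f g : 'rV[R]_n -> R) : Ck_on k f -> Ck_on k g -> Ck_on k (f + g).
Proof.
elim: k f g => [|k IH] f g fk gk.
  case=> // _ x Dx; apply: differentiableD; [exact: (fk [::])|exact: (gk [::])].
move/Ck_onS: fk => [df fk]; move/Ck_onS: gk => [dg gk].
apply/Ck_onS; split=> [x Dx|i]; first by apply: differentiableD; auto.
apply: (Ck_on_eq (f := pderive i f + pderive i g)); last exact: IH.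
by move=> y Dy; rewrite pderiveD//; auto.
Qed.

Lemma Ck_on_weaken (V : normedModType R) k (f : 'rV[R]_n -> V) :
  Ck_on k.+1 f -> Ck_on k f.
Proof. by move=> fk s sk; apply: fk; exact: leqW. Qed.

Lemma Ck_onM k (f g : 'rV[R]_n -> R) : Ck_on k f -> Ck_on k g -> Ck_on k (f * g).
Proof.
elim: k f g => [|k IH] f g fk gk.
  case=> // _ x Dx; apply: differentiableM; [exact: (fk [::])|exact: (gk [::])].
have := Ck_on_weaken gk; have := Ck_on_weaken fk.
move/Ck_onS: fk => [df fk]; move/Ck_onS: gk => [dg gk] f0 g0.
apply/Ck_onS; split=> [x Dx|i]; first by apply: differentiableM; auto.
apply: (Ck_on_eq (f := f * pderive i g + g * pderive i f)).
  by move=> y Dy; rewrite pderiveM//; auto.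
by apply: Ck_onD; exact: IH.
Qed.

Lemma Ck_on_sum (I : Type) (r : seq I) k (f : I -> 'rV[R]_n -> R) :
  (forall i, Ck_on k (f i)) -> Ck_on k (fun x => \sum_(i <- r) f i x).
Proof.
move=> fk; elim: r => [|i r IH].
  by apply: (Ck_on_eq (f := cst 0)); [move=> y _; rewrite big_nil|exact: Ck_on_cst].
apply: (Ck_on_eq (f := f i + (fun x => \sum_(i <- r) f i x))); last exact: Ck_onD.
by move=> y _; rewrite big_cons.
Qed.

Lemma derive_comp1 (f : 'rV[R]_n -> R) (h : R -> R) (dh : R) x v :
  differentiable f x -> is_derive (f x) 1 h dh ->
  differentiable (h \o f) x /\ 'D_v (h \o f) x = dh * 'D_v f x.
Proof.
move=> df [/derivable1_diffP hf <-].
have dc : differentiable (h \o f) x by exact: differentiable_comp.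
split=> //; rewrite !deriveE// diff_comp//=.
by rewrite -[X in 'd h _ X]mulr1 [LHS]linearZ mulrC.
Qed.

(** The derivative of 1/f is a product of 1/f, 1/f and a derivative of -f, so order [k] of 1/f
    itself yields order [k + 1]. *)
Lemma Ck_on_inv k (f : 'rV[R]_n -> R) : (forall x, D x -> f x != 0) ->
  Ck_on k f -> Ck_on k (fun x => (f x)^-1).
Proof.
move=> f0; elim: k => [|k IH].
  by move=> fk [|//] _ x Dx; apply: differentiableV (f0 _ Dx); exact: (fk [::]).
move=> fk; have {}IH := IH (Ck_on_weaken fk); move/Ck_onS: fk => [df fk].
apply/Ck_onS; split=> [x Dx|i]; first by apply: differentiableV; auto.
pose g := fun x => (f x)^-1.
apply: (Ck_on_eq (f := cst (-1) * (g * g * pderive i f))).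
  move=> y Dy; rewrite /pderive (deriveV (f0 _ Dy)); last exact/diff_derivable/df.
  rewrite /g -[RHS]/(- f y ^- 2 * 'D_(delta_mx 0 i) f y).
  by rewrite !fctE mulN1r -invfM -expr2 mulNr.
by do ?apply: Ck_onM => //; exact: Ck_on_cst.
Qed.

Lemma Ck_on_ln k (f : 'rV[R]_n -> R) : (forall x, D x -> 0 < f x) ->
  Ck_on k f -> Ck_on k (@ln R \o f).
Proof.
move=> f0 fk.
have d x v : D x -> differentiable (@ln R \o f) x /\ 'D_v (@ln R \o f) x = (f x)^-1 * 'D_v f x.
  move=> Dx; apply: derive_comp1 (Ck_on_differentiable fk Dx) _.
  exact: is_derive1_ln (f0 _ Dx).
case: k fk => [|k] fk; first by case=> // _ x Dx; exact: (d _ 0 Dx).1.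
apply/Ck_onS; split=> [x Dx|i]; first exact: (d _ 0 Dx).1.
apply: (Ck_on_eq (f := (fun x => (f x)^-1) * pderive i f)).
  by move=> y Dy; rewrite /pderive (d _ _ Dy).2.
apply: Ck_onM; last by move/Ck_onS: fk => [].
by apply: Ck_on_inv; [move=> x /f0/lt0r_neq0|exact: Ck_on_weaken].
Qed.

Lemma Ck_on_sqrt k (f : 'rV[R]_n -> R) : (forall x, D x -> 0 < f x) ->
  Ck_on k f -> Ck_on k (Num.sqrt \o f).
Proof.
move=> f0; elim: k => [|k IH] fk.
  case=> // _ x Dx.
  by apply: (derive_comp1 0 (Ck_on_differentiable fk Dx) (is_derive1_sqrt (f0 _ Dx))).1.
have d x v : D x -> differentiable (Num.sqrt \o f) x /\
    'D_v (Num.sqrt \o f) x = (2 * Num.sqrt (f x))^-1 * 'D_v f x.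
  move=> Dx; apply: derive_comp1 (Ck_on_differentiable fk Dx) _.
  exact: is_derive1_sqrt (f0 _ Dx).
apply/Ck_onS; split=> [x Dx|i]; first exact: (d _ 0 Dx).1.
apply: (Ck_on_eq (f := (fun x => ((cst 2 * (Num.sqrt \o f)) x)^-1) * pderive i f)).
  by move=> y Dy; rewrite /pderive (d _ _ Dy).2.
apply: Ck_onM; last by move/Ck_onS: fk => [].
apply: Ck_on_inv => [x /f0 fx|].
  by rewrite fctE mulf_neq0// gt_eqF// sqrtr_gt0.
by apply: Ck_onM; [exact: Ck_on_cst|exact/IH/Ck_on_weaken].
Qed.

Lemma derive_sum_pderive (f : 'rV[R]_n -> R) x v : differentiable f x ->
  'D_v f x = \sum_(i < n) v 0 i * pderive i f x.
Proof.
move=> df; rewrite deriveE// [in LHS](row_sum_delta v) linear_sum /=.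
by apply: eq_bigr => i _; rewrite linearZ /pderive deriveE.
Qed.

Lemma differentiable_mx p q (F : 'rV[R]_n -> 'M[R]_(p, q)) a b x :
  differentiable F x -> differentiable (fun y => F y a b : R) x.
Proof.
move=> dF.
have := differentiable_comp dF (differentiable_coord (F x) a b); exact.
Qed.

Lemma derive_mxE p q (F : 'rV[R]_n -> 'M[R]_(p, q)) a b x v :
  differentiable F x -> ('D_v F x) a b = 'D_v (fun y => F y a b : R) x.
Proof. by move=> dF; rewrite derive_mx ?mxE//; exact: diff_derivable. Qed.

Lemma smooth_on_coord p q (F : 'rV[R]_n -> 'M[R]_(p, q)) a b :
  smooth_on D F -> smooth_on D (fun y => F y a b : R).
Proof.
move=> /smooth_onP Fk; apply/smooth_onP => k; move/(_ k): Fk.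
elim: k F => [|k IH] F Fk.
  by case=> // _ x Dx; apply: differentiable_mx; exact: (Fk [::]).
move/Ck_onS: Fk => [dF Fk]; apply/Ck_onS; split=> [x Dx|i].
  by apply: differentiable_mx; exact: dF.
apply: Ck_on_eq (IH _ (Fk i)) => y Dy.
by rewrite /pderive derive_mxE//; exact: dF.
Qed.

End SmoothOn.

Section SmoothComp.
Context (R : realType) (m n : nat) (D : set 'rV[R]_m) (D' : set 'rV[R]_n).
Context (oD : open D).

Lemma derive_comp (Phi : 'rV[R]_m -> 'rV[R]_n) (f : 'rV[R]_n -> R) x v :
  differentiable Phi x -> differentiable f (Phi x) ->
  'D_v (f \o Phi) x = \sum_(a < n) 'D_v (fun y => Phi y 0 a) x * pderive a f (Phi x).
Proof.
move=> dPhi df; rewrite deriveE; last exact: differentiable_comp.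
rewrite diff_comp//= -(deriveE v dPhi) -(deriveE _ df) derive_sum_pderive//.
by apply: eq_bigr => a _; rewrite derive_mxE.
Qed.

(** Induction on the order with [f] varying: the chain rule leaves [Phi] in place and replaces [f]
    by its partial derivatives. *)
Lemma smooth_on_comp (Phi : 'rV[R]_m -> 'rV[R]_n) (f : 'rV[R]_n -> R) :
  (forall x, D x -> D' (Phi x)) ->
  smooth_on D Phi -> smooth_on D' f -> smooth_on D (f \o Phi).
Proof.
move=> DD' sPhi /smooth_onP fk; apply/smooth_onP => k.
have dPhi x : D x -> differentiable Phi x by exact: smooth_on_differentiable.
move/(_ k): fk; elim: k f => [|k IH] f fk.
  case=> // _ x Dx; apply: differentiable_comp; first exact: dPhi.
  by apply: (fk [::]) => //; exact: DD'.
move/Ck_onS: fk => [df fk]; apply/Ck_onS; split=> [x Dx|i].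
  by apply: differentiable_comp; [exact: dPhi|exact/df/DD'].
apply: (Ck_on_eq oD (f := fun x => \sum_(a < n)
  (pderive i (fun y => Phi y 0 a) * (pderive a f \o Phi)) x)).
  by move=> y Dy; rewrite /pderive derive_comp//; [exact: dPhi|exact/df/DD'].
apply: Ck_on_sum => // a; apply: Ck_onM => //; last exact: IH.
by move: k {IH fk}; apply/smooth_onP/smooth_on_pderive/smooth_on_coord.
Qed.

End SmoothComp.

(** * Levi-Civita connection over a differential ring *)

(** The derivations stand for the coordinate derivatives of a chart. [half] serves in the
    Christoffel symbols and makes doubling injective, which undoes the doubled Koszul formula. *)
Record diffring (n : nat) := DiffRing {
  dring :> comPzRingType;
  der : 'I_n -> dring -> dring;
  derD : forall i, {morph der i : f g / f + g};
  derM : forall i f g, der i (f * g) = der i f * g + f * der i g;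
  derC : forall i j f, der i (der j f) = der j (der i f);
  half : dring;
  half_half : half + half = 1 }.

(** The inverse Gram matrix is carried as a datum, because [A] is a ring of functions and not a
    field. *)
Record dmetric n (A : diffring n) := DMetric {
  dgram : 'M[A]_n;
  dgram_inv : 'M[A]_n;
  dgram_sym : dgram^T = dgram;
  dgramV : dgram *m dgram_inv = 1%:M }.

Section DiffRing.
Context (n : nat) (A : diffring n).
Implicit Types (f g a : A) (X Y Z W : 'rV[A]_n) (i j k l : 'I_n).

Lemma double_inj f g : f + f = g + g -> f = g.
Proof.
move=> fg; rewrite -[f]mul1r -[g]mul1r -(half_half A) !mulrDl -!mulrDr.
by rewrite fg.
Qed.

Lemma der0 i : der i (0 : A) = 0.
Proof. by apply: (@addrI _ (der i 0)); rewrite -derD !addr0. Qed.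

(** The vector field [X] as a derivation, X(f) in the usual notation. *)
Definition act X f : A := \sum_i X 0 i * der i f.

Lemma actDl X Y f : act (X + Y) f = act X f + act Y f.
Proof. by rewrite /act -big_split; apply: eq_bigr => i _; rewrite mxE mulrDl. Qed.

Lemma actZl a X f : act (a *: X) f = a * act X f.
Proof. by rewrite /act mulr_sumr; apply: eq_bigr => i _; rewrite mxE mulrA. Qed.

Lemma actDr X f g : act X (f + g) = act X f + act X g.
Proof. by rewrite /act -big_split; apply: eq_bigr => i _; rewrite derD mulrDr. Qed.

Lemma act0r X : act X 0 = 0.
Proof. by rewrite /act big1// => i _; rewrite der0 mulr0. Qed.

Lemma actNr X f : act X (- f) = - act X f.
Proof. by apply: (@addrI _ (act X f)); rewrite -actDr !subrr act0r. Qed.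

Lemma actMr X f g : act X (f * g) = act X f * g + f * act X g.
Proof.
rewrite /act mulr_suml mulr_sumr -big_split; apply: eq_bigr => i _.
by rewrite derM /=; ring.
Qed.

Lemma act1r X : act X 1 = 0.
Proof.
by have := actMr X 1 1; rewrite !mulr1 mul1r -[LHS]addr0 => /addrI <-.
Qed.

Lemma act_sumr X (I : Type) (r : seq I) (P : pred I) (F : I -> A) :
  act X (\sum_(x <- r | P x) F x) = \sum_(x <- r | P x) act X (F x).
Proof. by apply: (big_morph (act X) (actDr X) (act0r X)). Qed.

Definition vact X Y : 'rV[A]_n := \row_k act X (Y 0 k).

End DiffRing.

HB.lock Definition br n (A : diffring n) (X Y : 'rV[A]_n) : 'rV[A]_n :=
  vact X Y - vact Y X.

Section Bracket.
Context (n : nat) (A : diffring n).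
Implicit Types (f g a : A) (X Y Z W : 'rV[A]_n) (i j k l : 'I_n).

Lemma brE X Y k : br X Y 0 k = act X (Y 0 k) - act Y (X 0 k).
Proof. by rewrite br.unlock !mxE. Qed.

(** The second sum is symmetric in [X] and [Y] because the derivations commute, so it cancels in the
    commutator. *)
Lemma act_act X Y f : act X (act Y f) =
  \sum_i act X (Y 0 i) * der i f + \sum_i \sum_j X 0 i * Y 0 j * der i (der j f).
Proof.
rewrite {2}/act act_sumr; under eq_bigr do rewrite actMr.
rewrite big_split; congr (_ + _); rewrite exchange_big /=; apply: eq_bigr => j _.
by rewrite /act mulr_sumr; apply: eq_bigr => i _; ring.
Qed.

Lemma act_br X Y f : act (br X Y) f = act X (act Y f) - act Y (act X f).
Proof.
rewrite !act_act [X in _ + X - _]exchange_big /=.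
under [X in _ + X - _]eq_bigr do under eq_bigr do rewrite derC [X 0 _ * _]mulrC.
rewrite opprD addrACA subrr addr0 -sumrB; apply: eq_bigr => i _.
by rewrite brE mulrBl.
Qed.

Lemma brN X Y : br Y X = - br X Y.
Proof. by apply/rowP => k; rewrite mxE !brE opprB. Qed.

Lemma brZr a X Y : br X (a *: Y) = act X a *: Y + a *: br X Y.
Proof. by apply/rowP => k; rewrite !mxE !brE !mxE actMr actZl; ring. Qed.

Lemma brDr X Y Z : br X (Y + Z) = br X Y + br X Z.
Proof. by apply/rowP => k; rewrite !mxE !brE !mxE actDr actDl; ring. Qed.

Lemma brZl a X Y : br (a *: X) Y = - act Y a *: X + a *: br X Y.
Proof. by rewrite brN brZr [br Y X]brN opprD scalerN opprK scaleNr. Qed.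

Lemma brDl X Y Z : br (X + Y) Z = br X Z + br Y Z.
Proof. by rewrite brN brDr [br Z X]brN [br Z Y]brN opprD !opprK. Qed.

Lemma br_jacobi X Y Z : br X (br Y Z) + br Y (br Z X) + br Z (br X Y) = 0.
Proof.
apply/rowP => k; rewrite !mxE !brE.
by rewrite !act_br !actDr !actNr; ring.
Qed.

End Bracket.

Section Metric.
Context (n : nat) (A : diffring n) (M : dmetric A).
Implicit Types (f g a : A) (X Y Z W : 'rV[A]_n) (i j k l : 'I_n).
Local Notation G := (dgram M).
Local Notation Gi := (dgram_inv M).

Definition gg X Y : A := (X *m G *m Y^T) 0 0.

Lemma ggC X Y : gg X Y = gg Y X.
Proof.
rewrite /gg; have -> : X *m G *m Y^T = (Y *m G *m X^T)^T.
  by rewrite !trmx_mul !trmxK dgram_sym mulmxA.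
by rewrite mxE.
Qed.

Lemma ggDl X Y Z : gg (X + Y) Z = gg X Z + gg Y Z.
Proof. by rewrite /gg !mulmxDl mxE. Qed.

Lemma ggZl a X Z : gg (a *: X) Z = a * gg X Z.
Proof. by rewrite /gg -!scalemxAl mxE. Qed.

Lemma ggNl X Z : gg (- X) Z = - gg X Z.
Proof. by rewrite -scaleN1r ggZl mulN1r. Qed.

Lemma ggDr X Y Z : gg Z (X + Y) = gg Z X + gg Z Y.
Proof. by rewrite ggC ggDl !(ggC Z). Qed.

Lemma ggZr a X Z : gg Z (a *: X) = a * gg Z X.
Proof. by rewrite ggC ggZl (ggC Z). Qed.

Lemma ggNr X Z : gg Z (- X) = - gg Z X.
Proof. by rewrite ggC ggNl ggC. Qed.

Lemma gg0l Z : gg 0 Z = 0.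
Proof. by rewrite -(scale0r 0) ggZl mul0r. Qed.

Lemma gg_suml (I : Type) (r : seq I) (P : pred I) (F : I -> 'rV[A]_n) Z :
  gg (\sum_(x <- r | P x) F x) Z = \sum_(x <- r | P x) gg (F x) Z.
Proof. exact: (big_morph (gg^~ Z) (fun X Y => ggDl X Y Z) (gg0l Z)). Qed.

Lemma ggE X Y : gg X Y = \sum_i \sum_j X 0 i * G i j * Y 0 j.
Proof.
rewrite /gg mxE exchange_big /=; apply: eq_bigr => j _.
by rewrite mxE mulr_suml; apply: eq_bigr => i _; rewrite mxE.
Qed.

Lemma gg_delta i j : gg (delta_mx 0 i) (delta_mx 0 j) = G i j.
Proof. by rewrite /gg trmx_delta -rowE -colE !mxE. Qed.

Definition chr i j k : A :=
  half A * \sum_l Gi k l * (der i (G j l) + der j (G i l) - der l (G i j)).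

Definition Gam X Y : 'rV[A]_n := \row_k \sum_i \sum_j chr i j k * X 0 i * Y 0 j.

(** Twice the Christoffel symbol of the first kind. *)
Definition chr_low i j l : A := der i (G j l) + der j (G i l) - der l (G i j).

Lemma dgramE i j : G i j = G j i.
Proof. by rewrite -[in LHS](dgram_sym M) mxE. Qed.

(** Lowering the upper index cancels the inverse Gram matrix. *)
Lemma gg_Gam X Y Z :
  gg (Gam X Y) Z = half A * \sum_i \sum_j \sum_l X 0 i * Y 0 j * Z 0 l * chr_low i j l.
Proof.
pose L : 'rV[A]_n := \row_l \sum_i \sum_j X 0 i * Y 0 j * chr_low i j l.
have -> : Gam X Y = half A *: (L *m Gi^T).
  apply/rowP => k; rewrite !mxE /chr.
  under [in RHS]eq_bigr do rewrite !mxE mulr_suml.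
  rewrite [in RHS]exchange_big mulr_sumr /=; apply: eq_bigr => i _.
  under [in RHS]eq_bigr do rewrite mulr_suml.
  rewrite [in RHS]exchange_big mulr_sumr /=; apply: eq_bigr => j _.
  rewrite -!mulrA; congr (_ * _); rewrite mulr_suml; apply: eq_bigr => l _.
  by rewrite /chr_low; ring.
have GiG : Gi^T *m G = 1%:M.
  by rewrite -(dgram_sym M) -trmx_mul dgramV trmx1.
rewrite /gg -!scalemxAl mxE -[L *m _ *m _]mulmxA GiG mulmx1; congr (_ * _).
rewrite mxE; under eq_bigr do rewrite !mxE mulr_suml.
rewrite exchange_big /=; apply: eq_bigr => i _.
under eq_bigr do rewrite mulr_suml.
rewrite exchange_big /=; apply: eq_bigr => j _; apply: eq_bigr => l _.
by ring.
Qed.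

Lemma GamC X Y : Gam X Y = Gam Y X.
Proof.
apply/rowP => k; rewrite !mxE exchange_big /=; apply: eq_bigr => i _.
apply: eq_bigr => j _; rewrite mulrAC; congr (_ * _ * _).
rewrite /chr; congr (_ * _); apply: eq_bigr => l _.
by rewrite [G j i]dgramE; ring.
Qed.

End Metric.

HB.lock Definition nab n (A : diffring n) (M : dmetric A) (X Y : 'rV[A]_n) :=
  vact X Y + Gam M X Y.

Section LeviCivita.
Context (n : nat) (A : diffring n) (M : dmetric A).
Implicit Types (f g a : A) (X Y Z W : 'rV[A]_n) (i j k l : 'I_n).
Local Notation gg := (gg M).
Local Notation nab := (nab M).

Lemma nab_torsion X Y : nab X Y - nab Y X = br X Y.
Proof. by rewrite nab.unlock br.unlock /= GamC opprD addrACA subrr addr0. Qed.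

(** The sum [chr_low i j l + chr_low i l j] is twice [der i] of the Gram entry at (j, l); the rest
    is the product rule. *)
Lemma nab_metric X Y Z : act X (gg Y Z) = gg (nab X Y) Z + gg Y (nab X Z).
Proof.
rewrite nab.unlock ggDl ggDr [gg Y (Gam _ _ _)]ggC addrACA.
have -> : gg (Gam M X Y) Z + gg (Gam M X Z) Y =
    \sum_i \sum_j \sum_l X 0 i * Y 0 j * Z 0 l * der i (dgram M j l).
  rewrite !gg_Gam -mulrDr -big_split mulr_sumr; apply: eq_bigr => i _ /=.
  rewrite [X in _ + X]exchange_big /= -big_split mulr_sumr; apply: eq_bigr => j _ /=.
  rewrite -big_split mulr_sumr; apply: eq_bigr => l _ /=.
  rewrite /chr_low [dgram M l j]dgramE.
  rewrite -[RHS]mul1r -(half_half A); ring.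
rewrite [X in _ = _ + X]exchange_big /= !ggE act_sumr -!big_split /=.
apply: eq_bigr => j _; rewrite act_sumr [X in _ = _ + X]exchange_big /= -!big_split /=.
apply: eq_bigr => l _.
rewrite !mxE !actMr.
have -> : \sum_i X 0 i * Y 0 j * Z 0 l * der i (dgram M j l) =
    Y 0 j * act X (dgram M j l) * Z 0 l.
  by rewrite /act mulr_sumr mulr_suml; apply: eq_bigr => i _; ring.
by ring.
Qed.

Lemma nabDl X Y Z : nab (X + Y) Z = nab X Z + nab Y Z.
Proof.
rewrite nab.unlock; apply/rowP => k; rewrite !mxE actDl addrACA; congr (_ + _).
rewrite -big_split; apply: eq_bigr => i _; rewrite -big_split; apply: eq_bigr => j _.
by rewrite mxE /=; ring.
Qed.

Lemma nabZl a X Z : nab (a *: X) Z = a *: nab X Z.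
Proof.
rewrite nab.unlock; apply/rowP => k; rewrite !mxE actZl mulrDr; congr (_ + _).
rewrite mulr_sumr; apply: eq_bigr => i _; rewrite mulr_sumr; apply: eq_bigr => j _.
by rewrite mxE /=; ring.
Qed.

(** Torsion freeness in the form that carries the rules of the first argument over to the second. *)
Lemma nabE X Y : nab X Y = br X Y + nab Y X.
Proof. by rewrite -nab_torsion subrK. Qed.

Lemma nabDr X Y Z : nab X (Y + Z) = nab X Y + nab X Z.
Proof. by rewrite nabE nabDl brDr addrACA -!nabE. Qed.

Lemma nabZr a X Y : nab X (a *: Y) = act X a *: Y + a *: nab X Y.
Proof. by rewrite nabE brZr nabZl -addrA -scalerDr -nabE. Qed.

Lemma nabNl X Y : nab (- X) Y = - nab X Y.
Proof. by rewrite -scaleN1r nabZl scaleN1r. Qed.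

Lemma nab0l X : nab 0 X = 0.
Proof. by apply: (@addrI _ (nab 0 X)); rewrite -nabDl !addr0. Qed.

Lemma nab_suml X (I : Type) (r : seq I) (P : pred I) (F : I -> 'rV[A]_n) :
  nab (\sum_(x <- r | P x) F x) X = \sum_(x <- r | P x) nab (F x) X.
Proof. exact: (big_morph (nab^~ X) (fun Y Z => nabDl Y Z X) (nab0l X)). Qed.

Lemma koszul X Y Z : gg (nab X Y) Z + gg (nab X Y) Z =
  act X (gg Y Z) + act Y (gg X Z) - act Z (gg X Y)
  + gg (br X Y) Z - gg (br X Z) Y - gg (br Y Z) X.
Proof.
rewrite !nab_metric -!nab_torsion !ggDl !ggNl.
rewrite ![gg _ (nab _ _)]ggC; ring.
Qed.

Definition curv X Y Z : 'rV[A]_n :=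
  nab X (nab Y Z) - nab Y (nab X Z) - nab (br X Y) Z.

Lemma curv_lin1 Y Z : linear (fun X => curv X Y Z).
Proof.
move=> a X X'; rewrite /curv !(nabDl, nabDr, nabZl, nabZr, brDl, brZl).
by apply/rowP => k; rewrite !mxE; ring.
Qed.

Lemma curvN X Y Z : curv Y X Z = - curv X Y Z.
Proof. by rewrite /curv (brN X Y) nabNl; apply/rowP => k; rewrite !mxE; ring. Qed.

Lemma curv_lin2 X Z : linear (fun Y => curv X Y Z).
Proof.
move=> a Y Y'; rewrite curvN curv_lin1 [curv Y X Z]curvN [curv Y' X Z]curvN.
by rewrite scalerN opprD !opprK.
Qed.

(** The second derivatives of the coefficient cancel against the bracket term by [act_br]. *)
Lemma curv_lin3 X Y : linear (curv X Y).
Proof.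
move=> a Z Z'; rewrite /curv !(nabDr, nabZr, act_br).
by apply/rowP => k; rewrite !mxE; ring.
Qed.

Definition ric X Y : A := \sum_k curv (delta_mx 0 k) X Y 0 k.

Lemma ric_lin1 Y : scalar (ric^~ Y).
Proof.
move=> a X X'; rewrite /ric mulr_sumr -big_split; apply: eq_bigr => k _.
by rewrite curv_lin2 !mxE.
Qed.

Lemma ric_lin2 X : scalar (ric X).
Proof.
move=> a Y Y'; rewrite /ric mulr_sumr -big_split; apply: eq_bigr => k _.
by rewrite curv_lin3 !mxE.
Qed.

End LeviCivita.

Section Linear.
Context (n : nat) (A : comPzRingType) (W : lmodType A).

Lemma linear_on_sum (m : nat) (T : 'rV[A]_n -> W) (c : 'I_m -> A) E : linear T ->
  T (\sum_i c i *: E i) = \sum_i c i *: T (E i).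
Proof.
move=> linT; have TD X Y : T (X + Y) = T X + T Y.
  by have := linT 1 X Y; rewrite !scale1r.
have T0 : T 0 = 0 by apply: (@addrI _ (T 0)); rewrite -TD !addr0.
rewrite (big_morph T TD T0); apply: eq_bigr => i _.
by have := linT (c i) (E i) 0; rewrite T0 !addr0.
Qed.

End Linear.

Lemma scalar_on_sum (A : comPzRingType) n (m : nat) (T : 'rV[A]_n -> A)
    (c : 'I_m -> A) E : scalar T ->
  T (\sum_i c i *: E i) = \sum_i c i * T (E i).
Proof. by move=> linT; exact: (@linear_on_sum n A A^o). Qed.

(** * Orthonormal frames and tensors *)

(** Over a ring of functions this is tensoriality. *)
Definition bilin (A : comPzRingType) (V : lmodType A) (T : V -> V -> A) :=
  (forall Y, scalar (T^~ Y)) /\ (forall X, scalar (T X)).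

Lemma bilin_on_sum (A : comPzRingType) n m (T : 'rV[A]_n -> 'rV[A]_n -> A)
    (c d : 'I_m -> A) E E' : bilin T ->
  T (\sum_i c i *: E i) (\sum_j d j *: E' j) = \sum_i \sum_j c i * d j * T (E i) (E' j).
Proof.
move=> [T1 T2]; rewrite (scalar_on_sum _ _ (T1 _)); apply: eq_bigr => i _.
rewrite scalar_on_sum// mulr_sumr; apply: eq_bigr => j _.
by rewrite mulrA.
Qed.

Section OrthonormalFrame.
Context (A : comPzRingType) (n : nat) (G : 'M[A]_n) (E : 'I_n -> 'rV[A]_n).
Hypothesis onE : forall i j, (E i *m G *m (E j)^T) 0 0 = (i == j)%:R.
Implicit Types (X Y : 'rV[A]_n) (T : 'rV[A]_n -> 'rV[A]_n -> A).

Let P : 'M[A]_n := \matrix_i E i.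

Lemma rows_formE (B : 'M[A]_n) i j :
  (P *m B *m P^T) i j = (E i *m B *m (E j)^T) 0 0.
Proof.
rewrite [LHS]mxE [RHS]mxE; apply: eq_bigr => k _; rewrite !mxE; congr (_ * _).
by apply: eq_bigr => l _; rewrite !mxE.
Qed.

(** Orthonormality says [P *m G *m P^T = 1]. For square matrices over a commutative ring a one-sided
    inverse is two-sided, so an orthonormal family of [n] fields is a basis. *)
Lemma frame_mx_inv : G *m P^T *m P = 1%:M.
Proof.
apply: mulmx1C; apply/matrixP => i j.
by rewrite mulmxA rows_formE onE mxE.
Qed.

Lemma frame_expand X : X = \sum_i (X *m G *m (E i)^T) 0 0 *: E i.
Proof.
rewrite -[LHS]mulmx1 -frame_mx_inv !mulmxA mulmx_sum_row.
apply: eq_bigr => i _; rewrite rowK; congr (_ *: _).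
by rewrite [LHS]mxE [RHS]mxE; apply: eq_bigr => k _; rewrite !mxE.
Qed.

Lemma frame_trace_mx (B : 'M[A]_n) :
  \sum_i (E i *m B *m (E i)^T) 0 0 = \tr (B *m (P^T *m P)).
Proof.
rewrite mulmxA mxtrace_mulC mulmxA; apply: eq_bigr => i _.
by rewrite rows_formE.
Qed.

Lemma frame_trace (T : 'rV[A]_n -> 'rV[A]_n) : linear T ->
  \sum_i (T (E i) *m G *m (E i)^T) 0 0 = \sum_k T (delta_mx 0 k) 0 k.
Proof.
move=> linT; pose B : 'M[A]_n := \matrix_k T (delta_mx 0 k).
have TB X : T X = X *m B.
  rewrite mulmx_sum_row {1}(row_sum_delta X) linear_on_sum//.
  by apply: eq_bigr => k _; rewrite rowK.
transitivity (\sum_i (E i *m (B *m G) *m (E i)^T) 0 0).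
  by apply: eq_bigr => i _; rewrite TB !mulmxA.
rewrite frame_trace_mx -mulmxA [G *m _]mulmxA frame_mx_inv mulmx1.
by apply: eq_bigr => k _; rewrite mxE.
Qed.

Lemma bilin_frame_eq T T' : bilin T -> bilin T' ->
  (forall i j, T (E i) (E j) = T' (E i) (E j)) -> forall X Y, T X Y = T' X Y.
Proof.
move=> bT bT' TT' X Y; rewrite (frame_expand X) (frame_expand Y) !bilin_on_sum//.
by apply: eq_bigr => i _; apply: eq_bigr => j _; rewrite TT'.
Qed.

Lemma frame_gram_inv : P^T *m P *m G = 1%:M.
Proof. by apply: mulmx1C; rewrite mulmxA frame_mx_inv. Qed.

End OrthonormalFrame.

(** For either frame [P^T *m P] is the inverse of [G], so the trace depends on [B] and [G] only.
    This lets the frame in which the statement takes its traces be exchanged for the adapted one. *)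
Lemma trace_frame_independent (A : comPzRingType) n (G : 'M[A]_n)
    (E F : 'I_n -> 'rV[A]_n) (B : 'M[A]_n) :
  (forall i j, (E i *m G *m (E j)^T) 0 0 = (i == j)%:R) ->
  (forall i j, (F i *m G *m (F j)^T) 0 0 = (i == j)%:R) ->
  \sum_i (E i *m B *m (E i)^T) 0 0 = \sum_i (F i *m B *m (F i)^T) 0 0.
Proof.
move=> onE onF; rewrite !frame_trace_mx; congr (\tr (_ *m _)).
rewrite -[LHS]mulmx1 -(frame_mx_inv onF) !mulmxA (frame_gram_inv onE).
by rewrite mul1mx.
Qed.

Section Tensors.
Context (n : nat) (A : diffring n) (M : dmetric A).
Implicit Types (f g a : A) (X Y Z W U : 'rV[A]_n) (i j k l : 'I_n).
Local Notation gg := (gg M).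
Local Notation nab := (nab M).

(** Ring versions of [hessian], of the exterior derivative of [flat], of [nabla_form2] and of
    [lie_metric], taking fields as arguments. Their bilinearity is what makes constant extensions
    legitimate. *)
Definition dhess f X Y : A := act X (act Y f) - act (nab X Y) f.
Definition dext U X Y : A := act X (gg U Y) - act Y (gg U X) - gg U (br X Y).
Definition dnab2 (T : 'rV[A]_n -> 'rV[A]_n -> A) Z X Y : A :=
  act Z (T X Y) - T (nab Z X) Y - T X (nab Z Y).
Definition dlie Z X Y : A := act Z (gg X Y) - gg (br Z X) Y - gg X (br Z Y).

Lemma bilin_dhess f : bilin (dhess f).
Proof.
split=> [Y a X X'|X a Y Y']; rewrite /dhess.
  by rewrite !(actDl, actZl, nabDl, nabZl); ring.
by rewrite !(actDl, actZl, nabDr, nabZr, actDr, actMr); ring.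
Qed.

Lemma bilin_dext U : bilin (dext U).
Proof.
split=> [Y a X X'|X a Y Y']; rewrite /dext.
  by rewrite !(actDl, actZl, ggDr, ggZr, brDl, brZl, actDr, actMr, ggNr); ring.
by rewrite !(actDl, actZl, ggDr, ggZr, brDr, brZr, actDr, actMr, ggNr); ring.
Qed.

Lemma bilin_dlie Z : bilin (dlie Z).
Proof.
split=> [Y a X X'|X a Y Y']; rewrite /dlie.
  by rewrite !(ggDl, ggZl, brDr, brZr, actDr, actMr); ring.
by rewrite !(ggDr, ggZr, brDr, brZr, actDr, actMr); ring.
Qed.

Lemma dnab2_lin1 T X Y : bilin T -> scalar (fun Z => dnab2 T Z X Y).
Proof.
move=> [T1 T2] a Z Z'; rewrite /dnab2 !(actDl, actZl, nabDl, nabZl).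
by rewrite T1 T2; ring.
Qed.

Lemma scalarZ (V : lmodType A) (T : V -> A) a (X : V) : scalar T -> T (a *: X) = a * T X.
Proof.
move=> sT; have T0 : T 0 = 0.
  by have := sT 1 0 0; rewrite scale1r addr0 mul1r -[LHS]addr0 => /addrI <-.
by have := sT a X 0; rewrite T0 !addr0.
Qed.

Lemma scalarD (V : lmodType A) (T : V -> A) (X Y : V) : scalar T -> T (X + Y) = T X + T Y.
Proof. by move=> sT; have := sT 1 X Y; rewrite scale1r mul1r. Qed.

Lemma bilin_dnab2 T Z : bilin T -> bilin (dnab2 T Z).
Proof.
move=> [T1 T2]; split=> [Y a X X'|X a Y Y']; rewrite /dnab2 !(nabDr, nabZr).
  rewrite !(scalarD _ _ (T1 _)) !(scalarZ _ _ (T1 _)) actDr actMr; ring.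
rewrite !(scalarD _ _ (T2 _)) !(scalarZ _ _ (T2 _)) actDr actMr; ring.
Qed.

Lemma dlieE Z X Y : dlie Z X Y = gg (nab X Z) Y + gg X (nab Y Z).
Proof.
rewrite /dlie nab_metric -!(nab_torsion M) ggDl ggNl ggDr ggNr; ring.
Qed.

Lemma dext_horizontal U X Y : gg U X = 0 -> gg U Y = 0 ->
  dext U X Y = - gg U (br X Y).
Proof. by move=> UX UY; rewrite /dext UX UY !act0r subrr sub0r. Qed.

Section Frame.
Context (E : 'I_n -> 'rV[A]_n).
Hypothesis onE : forall i j, gg (E i) (E j) = (i == j)%:R.

Definition conn i j k := gg (nab (E i) (E j)) (E k).
Definition struct i j k := gg (br (E i) (E j)) (E k).

Lemma structN i j k : struct j i k = - struct i j k.
Proof. by rewrite /struct brN ggNl. Qed.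

Lemma struct_diag i k : struct i i k = 0.
Proof. by apply: double_inj; rewrite {1}structN addNr addr0. Qed.

Lemma gg_expand X : X = \sum_i gg X (E i) *: E i.
Proof. exact: (frame_expand onE). Qed.

Lemma gg_sum2 X Y : gg X Y = \sum_i gg X (E i) * gg Y (E i).
Proof.
rewrite {1}(gg_expand X) gg_suml; apply: eq_bigr => i _.
by rewrite ggZl [gg Y _]ggC.
Qed.

Lemma act_natr X (b : bool) : act X (b%:R : A) = 0.
Proof. by case: b; rewrite ?act1r ?act0r. Qed.

Lemma conn_koszul i j k : conn i j k + conn i j k =
  struct i j k - struct i k j - struct j k i.
Proof. by rewrite /conn koszul !onE !act_natr subr0 !add0r. Qed.

Lemma gg_nab_sum X i k : gg (nab (E i) X) (E k) =
  act (E i) (gg X (E k)) + \sum_m gg X (E m) * conn i m k.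
Proof.
have := nab_metric M (E i) X (E k).
rewrite [in X in _ = _ + X](gg_expand X) => ->; rewrite gg_suml -addrA -big_split /=.
rewrite big1 ?addr0// => m _; rewrite ggZl [gg (E m) _]ggC -mulrDr.
(* The inner products of the frame are constant, so [conn i] is antisymmetric in its last two
   indices. *)
have := nab_metric M (E i) (E k) (E m); rewrite onE act_natr /conn.
by rewrite [gg (E k) _]ggC => <-; rewrite mulr0.
Qed.

Lemma gg_curv i j k l : gg (curv M (E i) (E j) (E k)) (E l) =
  act (E i) (conn j k l) - act (E j) (conn i k l)
  + \sum_m (conn j k m * conn i m l - conn i k m * conn j m l
            - struct i j m * conn m k l).
Proof.
rewrite /curv !ggDl !ggNl (gg_nab_sum (nab _ _) i) (gg_nab_sum (nab _ _) j).
have -> : gg (nab (br (E i) (E j)) (E k)) (E l) = \sum_m struct i j m * conn m k l.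
  rewrite {1}(gg_expand (br _ _)) nab_suml gg_suml; apply: eq_bigr => m _.
  by rewrite nabZl ggZl.
by rewrite !sumrB /conn; ring.
Qed.

Lemma ric_frame X Y : ric M X Y = \sum_i gg (curv M (E i) X Y) (E i).
Proof. by rewrite /ric -(frame_trace onE (curv_lin1 M X Y)). Qed.

Lemma act_nab_frame i j f : act (nab (E i) (E j)) f = \sum_m conn i j m * act (E m) f.
Proof.
rewrite {1}(gg_expand (nab _ _)); have s : scalar (fun X => act X f).
  by move=> a X X'; rewrite actDl actZl.
by rewrite (scalar_on_sum _ _ s).
Qed.

Lemma bilin_nab_frame1 T i j Y : bilin T ->
  T (nab (E i) (E j)) Y = \sum_m conn i j m * T (E m) Y.
Proof. by move=> [T1 _]; rewrite {1}(gg_expand (nab _ _)) (scalar_on_sum _ _ (T1 Y)). Qed.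

Lemma bilin_nab_frame2 T i j Y : bilin T ->
  T Y (nab (E i) (E j)) = \sum_m conn i j m * T Y (E m).
Proof. by move=> [_ T2]; rewrite {1}(gg_expand (nab _ _)) scalar_on_sum. Qed.

Lemma dext_frame u i j : dext (E u) (E i) (E j) = - struct i j u.
Proof. by rewrite /dext !onE !act_natr subr0 sub0r ggC. Qed.

End Frame.
End Tensors.

(** * The Ricci tensor in an adapted frame *)

Definition o0 : 'I_3 := @Ordinal 3 0 isT.
Definition o1 : 'I_3 := @Ordinal 3 1 isT.
Definition o2 : 'I_3 := @Ordinal 3 2 isT.

Lemma ord3P (P : 'I_3 -> Prop) : P o0 -> P o1 -> P o2 -> forall i, P i.
Proof.
move=> P0 P1 P2 [[|[|[|//]]] hi]; [move: P0|move: P1|move: P2];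
  by congr P; apply: val_inj.
Qed.

Lemma sum3 (V : nmodType) (F : 'I_3 -> V) : \sum_i F i = F o0 + F o1 + F o2.
Proof.
rewrite !big_ord_recl big_ord0 addr0 addrA.
by congr (F _ + F _ + F _); apply: val_inj.
Qed.

Section RicciFrame.
Context (A : diffring 3) (M : dmetric A) (e : 'I_3 -> 'rV[A]_3).
Hypothesis onE : forall i j, gg M (e i) (e j) = (i == j)%:R.
Context (p q w a b1 b2 l k0 : A).

(* [e0, e1] = p e0 + q e1 + 2w u, [u, e0] = a e0 + b1 u and
   [u, e1] = a e1 + b2 u, where u = e2. *)
Definition struct_tab (i j k : nat) : A :=
  match i, j, k with
  | 0, 1, 0 => p | 0, 1, 1 => q | 0, 1, 2 => (w + w)%R
  | 1, 0, 0 => (- p)%R | 1, 0, 1 => (- q)%R | 1, 0, 2 => (- (w + w))%R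
  | 2, 0, 0 => a | 2, 0, 2 => b1 | 0, 2, 0 => (- a)%R | 0, 2, 2 => (- b1)%R
  | 2, 1, 1 => a | 2, 1, 2 => b2 | 1, 2, 1 => (- a)%R | 1, 2, 2 => (- b2)%R
  | _, _, _ => 0%R
  end%N.

(** The solution of [conn_koszul] for [struct_tab]; writing the vertical part of [e0, e1] as [w + w]
    keeps [half] out of it. *)
Definition conn_tab (i j k : nat) : A :=
  match i, j, k with
  | 0, 0, 1 => (- p)%R | 0, 0, 2 => a | 1, 1, 0 => q | 1, 1, 2 => a
  | 2, 2, 0 => (- b1)%R | 2, 2, 1 => (- b2)%R | 0, 1, 0 => p | 0, 1, 2 => w
  | 1, 0, 1 => (- q)%R | 1, 0, 2 => (- w)%R | 0, 2, 0 => (- a)%R | 0, 2, 1 => (- w)%R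
  | 1, 2, 0 => w | 1, 2, 1 => (- a)%R | 2, 0, 1 => (- w)%R | 2, 0, 2 => b1
  | 2, 1, 0 => w | 2, 1, 2 => b2
  | _, _, _ => 0%R
  end%N.

Hypothesis structE : forall i j k, struct M e i j k = struct_tab i j k.

Lemma connE i j k : conn M e i j k = conn_tab i j k.
Proof.
apply: double_inj; rewrite (conn_koszul onE) !structE.
by move: i j k; do 3!apply: ord3P => //=; ring.
Qed.

Local Notation D i f := (act (e i) f).
Local Notation P := (p + D o1 l).
Local Notation Q := (q - D o0 l).
(** [P] and [Q] will be [lam] times functions pulled back from N, so that a vertical derivative acts
    on [lam] only. [k0] stands for lambda^2 K^N, written through [P] and [Q]. *)
Hypothesis actl : D o2 l = a.
Hypothesis actP : D o2 P = a * P.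
Hypothesis actQ : D o2 Q = a * Q.
Hypothesis k0E : k0 = D o0 Q - D o0 l * Q - (D o1 P - D o1 l * P) - P * P - Q * Q.

Local Notation u := (e o2).
Definition mu3 := nab M u u.
Definition lap3 f := \sum_i dhess M f (e i) (e i).
Definition omega3 := dext M u.
Definition codiff3 X := - \sum_i dnab2 M omega3 (e i) (e i) X.
(** Twice the right-hand side of the theorem; accordingly [(w + w) * (w + w)] is half of ||I||^2. *)
Definition ric_rhs X Y : A :=
  (k0 + lap3 l + act mu3 l) *+ 2 * (gg M X Y - gg M u X * gg M u Y)
  - (w + w) * (w + w) * gg M X Y + dlie M mu3 X Y
  - (gg M mu3 X + a * gg M u X) * (gg M mu3 Y + a * gg M u Y) *+ 2
  - (a * gg M u X) * (a * gg M u Y) *+ 2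
  + (act X a * gg M u Y + act Y a * gg M u X) *+ 2
  + (codiff3 X * gg M u Y + codiff3 Y * gg M u X).

Lemma scalar_codiff3 : scalar codiff3.
Proof.
move=> c X Y; rewrite /codiff3.
have h i : dnab2 M omega3 (e i) (e i) (c *: X + Y) =
    c * dnab2 M omega3 (e i) (e i) X + dnab2 M omega3 (e i) (e i) Y.
  exact: (bilin_dnab2 M (e i) (bilin_dext M u)).2.
by rewrite (eq_bigr _ (fun i _ => h i)) big_split -mulr_sumr /=; ring.
Qed.

Lemma bilin_ric_rhs : bilin ric_rhs.
Proof.
have l1 Y c X X' : dlie M mu3 (c *: X + X') Y = c * dlie M mu3 X Y + dlie M mu3 X' Y.
  exact: (bilin_dlie M mu3).1.
have l2 X c Y Y' : dlie M mu3 X (c *: Y + Y') = c * dlie M mu3 X Y + dlie M mu3 X Y'.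
  exact: (bilin_dlie M mu3).2.
have lc c X X' : codiff3 (c *: X + X') = c * codiff3 X + codiff3 X'.
  exact: scalar_codiff3.
split=> [Y c X X'|X c Y Y']; rewrite /ric_rhs lc ?l1 ?l2
  !(ggDl, ggZl, ggDr, ggZr, actDl, actZl); ring.
Qed.

Lemma vect_expand3 i j :
  br (e i) (e j) = struct_tab i j 0 *: e o0 + struct_tab i j 1 *: e o1 + struct_tab i j 2 *: e o2.
Proof. by rewrite [LHS](gg_expand onE) sum3 -!/(struct _ _ _ _ _) !structE. Qed.

Lemma comm_act i j f : D i (D j f) = D j (D i f) +
  (struct_tab i j 0 * D o0 f + struct_tab i j 1 * D o1 f + struct_tab i j 2 * D o2 f).
Proof.
have := act_br (e i) (e j) f; rewrite vect_expand3 !actDl !actZl => ->.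
by rewrite addrC subrK.
Qed.

Lemma jacobi_vertical :
  D o2 w *+ 2 = D o0 b2 - D o1 b1 + a * w *+ 4 - b1 * p - b2 * q.
Proof.
have := br_jacobi (e o0) (e o1) (e o2).
rewrite !vect_expand3 /=.
rewrite !(scale0r, add0r, addr0, brDr, brZr) !vect_expand3 /=.
move=> /(congr1 (gg M u)).
rewrite !(ggDr, ggZr) !onE /= ggC gg0l.
rewrite !(actDr, actNr, act0r) => h.
by apply/eqP; rewrite -subr_eq0; apply/eqP; rewrite -h; ring.
Qed.

Lemma gg_mu3 i : gg M mu3 (e i) = conn_tab 2 2 i.
Proof. by rewrite -(connE o2 o2 i). Qed.

Lemma dlie3 i j : dlie M mu3 (e i) (e j) =
  D i (conn_tab 2 2 j) + \sum_(m < 3) conn_tab 2 2 m * conn_tab i m j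
  + (D j (conn_tab 2 2 i) + \sum_(m < 3) conn_tab 2 2 m * conn_tab j m i).
Proof.
rewrite dlieE [gg M (e i) _]ggC (gg_nab_sum onE mu3 i) (gg_nab_sum onE mu3 j) !gg_mu3.
by congr (_ + _ + (_ + _)); apply: eq_bigr => m _; rewrite gg_mu3 connE.
Qed.

Lemma act_mu3 f : act mu3 f = \sum_(m < 3) conn_tab 2 2 m * D m f.
Proof.
by rewrite /mu3 (act_nab_frame onE); apply: eq_bigr => m _; rewrite connE.
Qed.

Lemma dhess3 f i j : dhess M f (e i) (e j) =
  D i (D j f) - \sum_(m < 3) conn_tab i j m * D m f.
Proof.
by rewrite /dhess (act_nab_frame onE); congr (_ - _); apply: eq_bigr => m _; rewrite connE.
Qed.

Lemma omega3E i j : omega3 (e i) (e j) = - struct_tab i j 2.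
Proof. by rewrite /omega3 (dext_frame onE) structE. Qed.

Lemma dnab_omega3 i j k : dnab2 M omega3 (e i) (e j) (e k) =
  - D i (struct_tab j k 2) + \sum_(m < 3) conn_tab i j m * struct_tab m k 2
  + \sum_(m < 3) conn_tab i k m * struct_tab j m 2.
Proof.
rewrite /dnab2 omega3E actNr.
have bo : bilin omega3 by exact: bilin_dext.
rewrite (bilin_nab_frame1 onE _ _ _ bo) (bilin_nab_frame2 onE _ _ _ bo).
by congr (_ + _ + _); rewrite -sumrN; apply: eq_bigr => m _;
  rewrite connE omega3E mulrN opprK.
Qed.

Lemma ric3 j k : ric M (e j) (e k) =
  \sum_(i < 3) (D i (conn_tab j k i) - D j (conn_tab i k i)
  + \sum_(m < 3) (conn_tab j k m * conn_tab i m i - conn_tab i k m * conn_tab j m i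
            - struct_tab i j m * conn_tab m k i)).
Proof.
rewrite (ric_frame onE); apply: eq_bigr => i _; rewrite (gg_curv onE) !connE.
by congr (_ + _); apply: eq_bigr => m _; rewrite !connE structE.
Qed.

Theorem ric_formula X Y : ric M X Y *+ 2 = ric_rhs X Y.
Proof.
have bric : bilin (fun X Y => ric M X Y *+ 2).
  split=> [Z c V V'|Z c V V'].
    have -> : ric M (c *: V + V') Z = c * ric M V Z + ric M V' Z by exact: ric_lin1.
    ring.
  have -> : ric M Z (c *: V + V') = c * ric M Z V + ric M Z V' by exact: ric_lin2.
  ring.
apply: (bilin_frame_eq onE bric bilin_ric_rhs) X Y => i j.
rewrite /ric_rhs /lap3 /codiff3 dlie3 ric3 !act_mu3 !gg_mu3 !onE.
under [\sum_i dhess _ _ _ _]eq_bigr do rewrite dhess3.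
under [\sum_i0 dnab2 _ _ _ _ (e i)]eq_bigr do rewrite dnab_omega3.
under [\sum_i0 dnab2 _ _ _ _ (e j)]eq_bigr do rewrite dnab_omega3.
have aP := actP; have aQ := actQ; have J := jacobi_vertical.
have C0 := comm_act o2 o0 l; have C1 := comm_act o2 o1 l.
move: aP aQ C0 C1; rewrite !(actDr, actNr) /= actl k0E !(actDr, actNr).
move=> aP aQ C0 C1.
(* These two and the commutators [C0], [C1] eliminate the vertical derivatives of [p], [q] and of
   the horizontal derivatives of [l]. *)
have r20 : D o2 q = D o2 (D o0 l) + a * Q by rewrite -aQ; ring.
have r21 : D o2 p = - D o2 (D o1 l) + a * P by rewrite -aP; ring.
move: i j.
do 2!apply: ord3P; rewrite !sum3 /= !(actNr, actDr, act0r) ?actl ?r20 ?r21 ?C0 ?C1.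
- ring.
(* Component (e0, e1): the left side contains [D o2 w *+ 2], which is absent on the right, and the
   Jacobi identity supplies its value. In component (e1, e0) below it occurs with the opposite
   sign. *)
- by apply: subr0_eq; rewrite -[RHS](subrr (D o2 w *+ 2)) [X in _ = _ - X]J; ring.
- ring.
- by apply: subr0_eq; rewrite -[RHS](subrr (D o2 w *+ 2)) [X in _ = X - _]J; ring.
- ring.
- ring.
- ring.
- ring.
- ring.
Qed.

End RicciFrame.

Section Evaluation.
Context (A : diffring 3) (R : comPzRingType) (phi : {rmorphism dring A -> R}).
Context (M : dmetric A) (e : 'I_3 -> 'rV[A]_3).
Hypothesis onE : forall i j, gg M (e i) (e j) = (i == j)%:R.
Implicit Types (X Y : 'rV[A]_3).

Lemma ric_rhs_eval w a l k0 X Y : phi (ric_rhs M e w a l k0 X Y) =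
  (phi k0 + phi (lap3 M e l) + phi (act (mu3 M e) l)) *+ 2
    * (phi (gg M X Y) - phi (gg M (e o2) X) * phi (gg M (e o2) Y))
  - phi (w + w) * phi (w + w) * phi (gg M X Y) + phi (dlie M (mu3 M e) X Y)
  - (phi (gg M (mu3 M e) X) + phi a * phi (gg M (e o2) X))
    * (phi (gg M (mu3 M e) Y) + phi a * phi (gg M (e o2) Y)) *+ 2
  - (phi a * phi (gg M (e o2) X)) * (phi a * phi (gg M (e o2) Y)) *+ 2
  + (phi (act X a) * phi (gg M (e o2) Y) + phi (act Y a) * phi (gg M (e o2) X)) *+ 2
  + (phi (codiff3 M e X) * phi (gg M (e o2) Y) + phi (codiff3 M e Y) * phi (gg M (e o2) X)).
Proof.
by rewrite /ric_rhs; ring.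
Qed.

(** Horizontality is required after evaluation only: the horizontal vectors of the statement live at
    one point, and their constant extensions need not remain horizontal. *)
Lemma gg_eval_horizontal X Y : phi (gg M X (e o2)) = 0 ->
  phi (gg M X Y) = phi (gg M X (e o0)) * phi (gg M Y (e o0))
                   + phi (gg M X (e o1)) * phi (gg M Y (e o1)).
Proof.
by move=> X2; rewrite (gg_sum2 onE) sum3 !(rmorphD, rmorphM) X2 mul0r addr0.
Qed.

(** On the horizontal plane a 2-form is a multiple of the determinant, the factor being its value on
    (e0, e1). *)
Lemma dext_eval_horizontal X Y : phi (gg M X (e o2)) = 0 -> phi (gg M Y (e o2)) = 0 ->
  phi (dext M (e o2) X Y) = - (phi (struct M e o0 o1 o2) *
    (phi (gg M X (e o0)) * phi (gg M Y (e o1)) - phi (gg M X (e o1)) * phi (gg M Y (e o0)))).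
Proof.
move=> X2 Y2; rewrite {1}(gg_expand onE X) {1}(gg_expand onE Y).
rewrite (bilin_on_sum _ _ _ _ (bilin_dext M (e o2))) sum3 !sum3 !(dext_frame onE).
rewrite !struct_diag (structN M e o0 o1) !(rmorphD, rmorphN, rmorphM, rmorph0) X2 Y2; ring.
Qed.

End Evaluation.

(** * Semi-conformal submersions over differential rings *)

Section CurvatureExpansion.
Context (n : nat) (A : diffring n) (M : dmetric A) (E : 'I_n -> 'rV[A]_n).

Lemma gg_curv_sum X Y Z W : (forall i j, gg M (E i) (E j) = (i == j)%:R) ->
  gg M (curv M X Y Z) W = \sum_i \sum_j \sum_k \sum_l
    gg M X (E i) * gg M Y (E j) * gg M Z (E k) * gg M W (E l)
    * gg M (curv M (E i) (E j) (E k)) (E l).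
Proof.
move=> onE; rewrite {1}(gg_expand onE X) (linear_on_sum _ _ (curv_lin1 M Y Z)) gg_suml.
apply: eq_bigr => i _; rewrite {1}(gg_expand onE Y).
rewrite (linear_on_sum _ _ (curv_lin2 M (E i) Z)) scaler_sumr gg_suml.
apply: eq_bigr => j _; rewrite {1}(gg_expand onE Z).
rewrite (linear_on_sum _ _ (curv_lin3 M (E i) (E j))) !scaler_sumr gg_suml.
apply: eq_bigr => k _; rewrite {1}(gg_expand onE W) [LHS]ggC gg_suml.
by apply: eq_bigr => l _; rewrite !ggZl !ggZr [gg M (E l) _]ggC; ring.
Qed.

End CurvatureExpansion.

(** * Gauss curvature of a surface from an orthonormal frame *)

Section Surface.

Definition p0 : 'I_2 := @Ordinal 2 0 isT.
Definition p1 : 'I_2 := @Ordinal 2 1 isT.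

Lemma ord2P (P : 'I_2 -> Prop) : P p0 -> P p1 -> forall i, P i.
Proof.
by move=> P0 P1 [[|[|//]] hi]; [move: P0|move: P1]; congr P; apply: val_inj.
Qed.

Lemma sum2 (V : nmodType) (F : 'I_2 -> V) : \sum_i F i = F p0 + F p1.
Proof.
by rewrite !big_ord_recl big_ord0 addr0; congr (F _ + F _); apply: val_inj.
Qed.

Context (B : diffring 2) (M : dmetric B) (F : 'I_2 -> 'rV[B]_2).
Hypothesis onF : forall i j, gg M (F i) (F j) = (i == j)%:R.

(** The classical expression F0(c2) - F1(c1) - c1^2 - c2^2, where [F0, F1] = c1 F0 + c2 F1. *)
Definition surface_curv : B :=
  act (F p0) (struct M F p0 p1 p1) - act (F p1) (struct M F p0 p1 p0)
  - struct M F p0 p1 p0 ^+ 2 - struct M F p0 p1 p1 ^+ 2.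

Let c1 := struct M F p0 p1 p0.
Let c2 := struct M F p0 p1 p1.

Definition conn_tab2 (i j k : nat) : B :=
  match i, j, k with
  | 0, 0, 1 => - c1 | 1, 1, 0 => c2 | 0, 1, 0 => c1 | 1, 0, 1 => - c2
  | _, _, _ => 0
  end%R%N.

Lemma conn2E i j k : conn M F i j k = conn_tab2 i j k.
Proof.
apply: double_inj; rewrite (conn_koszul onF).
by move: i j k; do 3!apply: ord2P => /=; rewrite ?struct_diag ?(structN _ _ p0 p1);
  rewrite -/c1 -/c2; ring.
Qed.

(** Sectional curvature cleared of its denominator. It allows [F] to be orthonormal while the
    curvature of N is defined through coordinate fields. *)
Lemma gg_curv_surface X Y :
  gg M (curv M X Y Y) X = surface_curv * (gg M X X * gg M Y Y - gg M X Y ^+ 2).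
Proof.
rewrite (gg_curv_sum _ _ _ _ onF) !(gg_sum2 onF) !sum2 !(gg_curv onF) !sum2 !conn2E /=.
rewrite !struct_diag !(structN _ _ p0 p1) -/c1 -/c2 /surface_curv -/c1 -/c2.
by rewrite !(actNr, act0r); ring.
Qed.

End Surface.

(** * Horizontal lifts and the adapted frame of a semi-conformal submersion *)

Section Submersion.
Context (A : diffring 3) (B : diffring 2) (pull : {rmorphism dring B -> dring A}).
Context (Phi : 'I_2 -> A).
Hypothesis chain : forall i f,
  der i (pull f) = \sum_c der i (Phi c) * pull (der c f).
Context (M : dmetric A) (H : dmetric B) (U : 'rV[A]_3) (lam lami l : A).
Let J : 'M[A]_(3, 2) := \matrix_(i, c) der i (Phi c).
Local Notation G := (dgram M).
Local Notation Gi := (dgram_inv M).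
Let pH : 'M[A]_2 := map_mx pull (dgram H).
Hypothesis UU : gg M U U = 1.
Hypothesis UJ : U *m J = 0.
Hypothesis lamK : lam * lami = 1.
Hypothesis der_lam : forall i, der i lam = lam * der i l.
(** Semi-conformality without horizontal vectors: up to transposition ([conformalC]) it says that
    the differential of phi composed with its metric adjoint is lambda^2 times the identity. *)
Hypothesis conformal : J^T *m Gi *m J *m pH = (lam ^+ 2)%:M.
Context (F : 'I_2 -> 'rV[B]_2).
Hypothesis onF : forall i j, gg H (F i) (F j) = (i == j)%:R.

Implicit Types (v w : 'rV[B]_2) (X Y Z : 'rV[A]_3).

Lemma mulJE X c : (X *m J) 0 c = act X (Phi c).
Proof. by rewrite mxE /act; apply: eq_bigr => i _; rewrite mxE. Qed.

Lemma act_pull X f : act X (pull f) = \sum_c (X *m J) 0 c * pull (der c f).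
Proof.
rewrite /act; under eq_bigr do rewrite chain mulr_sumr.
rewrite exchange_big; apply: eq_bigr => c _ /=.
by rewrite mulJE /act mulr_suml; apply: eq_bigr => i _; rewrite mulrA.
Qed.

(** The equation [X *m J = map_mx pull v] expresses that [X] and [v] are phi-related. *)
Lemma act_pull_rel X v f : X *m J = map_mx pull v -> act X (pull f) = pull (act v f).
Proof.
move=> Xv; rewrite act_pull Xv /act rmorph_sum; apply: eq_bigr => c _.
by rewrite mxE rmorphM.
Qed.

Lemma act_pull_vertical X f : X *m J = 0 -> act X (pull f) = 0.
Proof. by move=> X0; rewrite act_pull X0 big1// => c _; rewrite mxE mul0r. Qed.

Lemma br_rel X Y v w : X *m J = map_mx pull v -> Y *m J = map_mx pull w ->
  br X Y *m J = map_mx pull (br v w).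
Proof.
move=> Xv Yw; apply/rowP => c; rewrite mulJE act_br -!mulJE Xv Yw !mxE brE.
by rewrite (act_pull_rel _ Xv) (act_pull_rel _ Yw) rmorphB.
Qed.

Lemma br_vertical X Y v : X *m J = 0 -> Y *m J = map_mx pull v -> br X Y *m J = 0.
Proof.
move=> X0 Yv; apply/rowP => c; rewrite mulJE act_br -!mulJE X0 Yv !mxE.
by rewrite act_pull_vertical// act0r subrr.
Qed.

(** The horizontal lift is lambda^-2 times the metric adjoint of the differential of phi: the image
    of the adjoint is orthogonal to the kernel, and [conformalC] shows that the result projects to
    [v]. *)
Definition lift v : 'rV[A]_3 :=
  locked (lami ^+ 2 *: (map_mx pull v *m pH *m J^T *m Gi)).

Let lamiK : lami * lam = 1. Proof. by rewrite mulrC. Qed.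

Lemma pH_sym : pH^T = pH.
Proof. by apply/matrixP => i j; rewrite !mxE dgramE. Qed.

Lemma Gi_sym : Gi^T = Gi.
Proof.
have h : Gi^T *m G = 1%:M by rewrite -(dgram_sym M) -trmx_mul dgramV trmx1.
by rewrite -[LHS]mulmx1 -(dgramV M) mulmxA h mul1mx.
Qed.

Lemma conformalC : pH *m (J^T *m Gi *m J) = (lam ^+ 2)%:M.
Proof.
have := congr1 trmx conformal; rewrite !trmx_mul trmxK pH_sym Gi_sym tr_scalar_mx.
by rewrite !mulmxA.
Qed.

Lemma lift_rel v : lift v *m J = map_mx pull v.
Proof.
rewrite /lift -lock -scalemxAl -!mulmxA [J^T *m _]mulmxA conformalC.
by rewrite mul_mx_scalar scalerA -exprMn lamiK expr1n scale1r.
Qed.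

Lemma gg_lift Z v : gg M Z (lift v) = lami ^+ 2 * (Z *m J *m pH *m (map_mx pull v)^T) 0 0.
Proof.
rewrite /lift -lock ggZr /gg !trmx_mul trmxK Gi_sym pH_sym; congr (_ * _).
by rewrite !mulmxA -[Z *m G *m Gi]mulmxA dgramV mulmx1.
Qed.

Lemma gg_lift_rel Z v w : Z *m J = map_mx pull w ->
  gg M Z (lift v) = lami ^+ 2 * pull (gg H w v).
Proof.
move=> Zw; rewrite gg_lift Zw /pH.
have -> : (map_mx pull v)^T = map_mx pull v^T by apply/matrixP => i j; rewrite !mxE.
by rewrite -!map_mxM mxE.
Qed.

Lemma gg_lift_vertical Z v : Z *m J = 0 -> gg M Z (lift v) = 0.
Proof. by move=> Z0; rewrite gg_lift Z0 !mul0mx mxE mulr0. Qed.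

Definition adapted_frame (i : 'I_3) : 'rV[A]_3 :=
  match val i with
  | 0 => lam *: lift (F p0) | 1 => lam *: lift (F p1) | _ => U end%N.

Local Notation e := adapted_frame.

Lemma pull_natr (b : bool) : pull b%:R = b%:R.
Proof. by case: b; rewrite ?rmorph1 ?rmorph0. Qed.

Lemma adapted_on i j : gg M (e i) (e j) = (i == j)%:R.
Proof.
have hab a b : gg M (lam *: lift (F a)) (lam *: lift (F b)) = (a == b)%:R.
  rewrite ggZl ggZr (gg_lift_rel _ (lift_rel _)) onF pull_natr.
  transitivity ((lam * lami) ^+ 2 * (a == b)%:R); first by ring.
  by rewrite lamK expr1n mul1r.
have hU a : gg M U (lam *: lift (F a)) = 0.
  by rewrite ggZr gg_lift_vertical// mulr0.
by move: i j; do 2!apply: ord3P; rewrite /e /= ?hab ?[gg M _ U]ggC ?hU ?UU.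
Qed.

Lemma act_lam X : act X lam = lam * act X l.
Proof.
by rewrite /act mulr_sumr; apply: eq_bigr => i _; rewrite der_lam mulrCA.
Qed.

Local Notation D i f := (act (e i) f).
Local Notation c1 := (struct H F p0 p1 p0).
Local Notation c2 := (struct H F p0 p1 p1).

(** The bracket of the lifts is phi-related to the bracket on N; the product rule adds derivatives
    of [lam], which become [lam] times derivatives of [l]. *)
Lemma gg_br_lift (i : 'I_2) : gg M (br (lam *: lift (F p0)) (lam *: lift (F p1)))
   (lam *: lift (F i)) = lam * pull (struct H F p0 p1 i)
   + lam * act (lift (F p0)) l * (p1 == i)%:R - lam * act (lift (F p1)) l * (p0 == i)%:R.
Proof.
rewrite brZl brZr actZl !act_lam !(ggDl, ggZl, ggZr).
rewrite !(gg_lift_rel _ (lift_rel _)) (gg_lift_rel _ (br_rel (lift_rel _) (lift_rel _))).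
rewrite -/(struct H F p0 p1 i) !onF !pull_natr.
move: (pull _) (act (lift (F p0)) l) (act (lift (F p1)) l) ((p1 == i)%:R) ((p0 == i)%:R).
move=> s x y d d'.
transitivity ((lam * lami) ^+ 2 * (lam * s + lam * x * d - lam * y * d')).
  by ring.
by rewrite lamK; ring.
Qed.

(** The bracket of [U] with a lift is vertical, so the horizontal part comes from the derivative of
    the factor [lam] alone. *)
Lemma gg_br_vert_lift (i j : 'I_2) : gg M (br U (lam *: lift (F i))) (lam *: lift (F j))
  = act U l * (i == j)%:R.
Proof.
rewrite brZr act_lam !(ggDl, ggZl, ggZr).
rewrite (gg_lift_vertical _ (br_vertical UJ (lift_rel _))).
rewrite (gg_lift_rel _ (lift_rel _)) onF pull_natr.
move: (act _ _) (_%:R) => x d.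
transitivity ((lam * lami) ^+ 2 * (x * d)); first by ring.
by rewrite lamK; ring.
Qed.

Let w := half A * struct M e o0 o1 o2.
Let p := struct M e o0 o1 o0.
Let q := struct M e o0 o1 o1.

Lemma horizontal_struct : struct M e o0 o1 o2 = w + w.
Proof. by rewrite -mulrDl half_half mul1r. Qed.

Lemma pE : p + D o1 l = lam * pull c1.
Proof. by rewrite /p /struct /e /= gg_br_lift actZl eqxx /=; ring. Qed.

Lemma qE : q - D o0 l = lam * pull c2.
Proof. by rewrite /q /struct /e /= gg_br_lift actZl eqxx /=; ring. Qed.

Lemma adapted_struct i j k : struct M e i j k =
  struct_tab p q w (act U l) (struct M e o2 o0 o2) (struct M e o2 o1 o2) i j k.
Proof.
have s20 : struct M e o2 o0 o0 = act U l.
  by rewrite /struct /e /= gg_br_vert_lift mulr1.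
have s201 : struct M e o2 o0 o1 = 0.
  by rewrite /struct /e /= gg_br_vert_lift mulr0.
have s21 : struct M e o2 o1 o1 = act U l.
  by rewrite /struct /e /= gg_br_vert_lift mulr1.
have s210 : struct M e o2 o1 o0 = 0.
  by rewrite /struct /e /= gg_br_vert_lift mulr0.
have N01 k' := structN M e o0 o1 k'.
have N20 k' := structN M e o2 o0 k'.
have N21 k' := structN M e o2 o1 k'.
move: i j k; do 3!apply: ord3P => /=;
  rewrite ?struct_diag ?N01 ?N20 ?N21 ?s20 ?s201 ?s21 ?s210 ?oppr0 -?horizontal_struct //.
Qed.

Lemma pull_deriv_horizontal i (j : 'I_2) f : e i = lam *: lift (F j) ->
  D i (lam * pull f) - D i l * (lam * pull f) = lam ^+ 2 * pull (act (F j) f).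
Proof.
by move=> ->; rewrite !actZl actMr act_lam (act_pull_rel _ (lift_rel _)); ring.
Qed.

Lemma ric_submersion X Y : ric M X Y *+ 2 =
  ric_rhs M e w (act U l) l (lam ^+ 2 * pull (surface_curv H F)) X Y.
Proof.
have DP f : act U (lam * pull f) = act U l * (lam * pull f).
  by rewrite actMr act_lam act_pull_vertical//; ring.
apply: (ric_formula adapted_on adapted_struct) => //; rewrite ?pE ?qE ?DP//.
rewrite (pull_deriv_horizontal c2 (erefl : e o0 = lam *: lift (F p0))).
rewrite (pull_deriv_horizontal c1 (erefl : e o1 = lam *: lift (F p1))).
by rewrite /surface_curv !rmorphB !rmorphXn; ring.
Qed.

End Submersion.

(** * The differential ring of smooth functions *)

Record region (R : realType) (n : nat) := Region {
  region_set :> 'rV[R]_n -> Prop;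
  region_open : open (region_set : set _) }.

(* The value 0 outside of [D] makes Leibniz equality agree with equality on [D]. *)
Record sfun (R : realType) (n : nat) (D : region R n) := Sfun {
  sfun_val :> 'rV[R]_n -> R;
  sfun_smooth : smooth_on D sfun_val;
  sfun_out : forall y, ~ D y -> sfun_val y = 0 }.

HB.instance Definition _ R n (D : region R n) := gen_eqMixin (sfun D).
HB.instance Definition _ R n (D : region R n) := gen_choiceMixin (sfun D).

Section SmoothFunctions.
Context (R : realType) (n : nat) (D : region R n).
Implicit Types (f g h : sfun D) (F : 'rV[R]_n -> R).

Let oD := @region_open _ _ D.

Lemma sfunP f g : (forall y, D y -> f y = g y) -> f = g.
Proof.
move=> fg; have {}fg : sfun_val f = sfun_val g.
  apply/funext => y; have [/fg//|nDy] := pselect (D y).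
  by rewrite !sfun_out.
case: f g fg => [f sf f0] [g sg g0] /= fg; subst g.
by congr Sfun; exact: Prop_irrelevance.
Qed.

Lemma smooth_on_eq F F' : (forall y, D y -> F y = F' y) ->
  smooth_on D F -> smooth_on D F'.
Proof.
by move=> FF' /smooth_onP h; apply/smooth_onP => k; apply: Ck_on_eq FF' (h k).
Qed.

Definition cutoff F := fun y => if `[< D y >] then F y else 0.

Lemma cutoffE F y : D y -> cutoff F y = F y.
Proof. by rewrite /cutoff => Dy; case: asboolP. Qed.

Lemma smooth_cutoff F : smooth_on D F -> smooth_on D (cutoff F).
Proof. by apply: smooth_on_eq => y Dy; rewrite cutoffE. Qed.

Lemma cutoff_out F y : ~ D y -> cutoff F y = 0.
Proof. by rewrite /cutoff; case: asboolP. Qed.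

Definition sfun_of F (sF : smooth_on D F) : sfun D :=
  Sfun (smooth_cutoff sF) (@cutoff_out F).

Lemma sfun_ofE F (sF : smooth_on D F) y : D y -> sfun_of sF y = F y.
Proof. exact: cutoffE. Qed.

Lemma smooth_onD F F' : smooth_on D F -> smooth_on D F' -> smooth_on D (F + F').
Proof.
by move=> /smooth_onP h /smooth_onP h'; apply/smooth_onP => k; exact: Ck_onD.
Qed.

Lemma smooth_onM F F' : smooth_on D F -> smooth_on D F' -> smooth_on D (F * F').
Proof.
by move=> /smooth_onP h /smooth_onP h'; apply/smooth_onP => k; exact: Ck_onM.
Qed.

Lemma smooth_on_cst (a : R) : smooth_on D (cst a : 'rV[R]_n -> R).
Proof. by apply/smooth_onP => k; exact: Ck_on_cst. Qed.

Definition sfun_cst a := sfun_of (smooth_on_cst a).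
Definition sfun_add f g := sfun_of (smooth_onD (sfun_smooth f) (sfun_smooth g)).
Definition sfun_mul f g := sfun_of (smooth_onM (sfun_smooth f) (sfun_smooth g)).
Definition sfun_opp f := sfun_mul (sfun_cst (-1)) f.

Lemma sfun_cstE0 a y : D y -> sfun_cst a y = a. Proof. exact: cutoffE. Qed.

Lemma sfun_addE f g y : D y -> sfun_add f g y = f y + g y. Proof. exact: cutoffE. Qed.

Lemma sfun_mulE f g y : D y -> sfun_mul f g y = f y * g y. Proof. exact: cutoffE. Qed.

Lemma sfun_oppE f y : D y -> sfun_opp f y = - f y.
Proof. by move=> Dy; rewrite sfun_mulE// sfun_cstE0// mulN1r. Qed.

Let sfunE := (sfun_cstE0, sfun_oppE, sfun_addE, sfun_mulE).

Lemma sfun_addA : associative sfun_add.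
Proof. by move=> f g h; apply: sfunP => y Dy; rewrite !sfunE// addrA. Qed.

Lemma sfun_addC : commutative sfun_add.
Proof. by move=> f g; apply: sfunP => y Dy; rewrite !sfunE// addrC. Qed.

Lemma sfun_add0 : left_id (sfun_cst 0) sfun_add.
Proof. by move=> f; apply: sfunP => y Dy; rewrite !sfunE// add0r. Qed.

Lemma sfun_addN : left_inverse (sfun_cst 0) sfun_opp sfun_add.
Proof. by move=> f; apply: sfunP => y Dy; rewrite !sfunE// addNr. Qed.

Lemma sfun_mulA : associative sfun_mul.
Proof. by move=> f g h; apply: sfunP => y Dy; rewrite !sfunE// mulrA. Qed.

Lemma sfun_mulC : commutative sfun_mul.
Proof. by move=> f g; apply: sfunP => y Dy; rewrite !sfunE// mulrC. Qed.

Lemma sfun_mul1 : left_id (sfun_cst 1) sfun_mul.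
Proof. by move=> f; apply: sfunP => y Dy; rewrite !sfunE// mul1r. Qed.

Lemma sfun_mulDl : left_distributive sfun_mul sfun_add.
Proof. by move=> f g h; apply: sfunP => y Dy; rewrite !sfunE// mulrDl. Qed.

HB.instance Definition _ := GRing.isZmodule.Build (sfun D)
  sfun_addA sfun_addC sfun_add0 sfun_addN.
HB.instance Definition _ := GRing.Zmodule_isComPzRing.Build (sfun D)
  sfun_mulA sfun_mulC sfun_mul1 sfun_mulDl.

Lemma sfunD f g y : D y -> (f + g) y = f y + g y. Proof. exact: cutoffE. Qed.

Lemma sfunM f g y : D y -> (f * g) y = f y * g y. Proof. exact: cutoffE. Qed.

Lemma sfunN f y : D y -> (- f) y = - f y. Proof. exact: sfun_oppE. Qed.

Lemma sfun1 y : D y -> (1 : sfun D) y = 1. Proof. exact: cutoffE. Qed.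

Lemma sfun0 y : (0 : sfun D) y = 0.
Proof. by rewrite /= /cutoff; case: asboolP. Qed.

Lemma sfun_sum (I : Type) (r : seq I) (P : pred I) (F : I -> sfun D) y : D y ->
  (\sum_(i <- r | P i) F i) y = \sum_(i <- r | P i) F i y.
Proof.
by move=> Dy; apply: (big_morph (fun f : sfun D => f y)); [move=> f g; exact: sfunD|exact: sfun0].
Qed.

Definition sfun_der (i : 'I_n) f := sfun_of (smooth_on_pderive i (sfun_smooth f)).

Lemma sfun_derE i f y : D y -> sfun_der i f y = pderive i f y.
Proof. exact: cutoffE. Qed.

Lemma sfun_diff f y : D y -> differentiable f y.
Proof. exact/smooth_on_differentiable/sfun_smooth. Qed.

Lemma sfun_derD i : {morph sfun_der i : f g / f + g}.
Proof.
move=> f g; apply: sfunP => y Dy; rewrite sfunD// !sfun_derE//.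
rewrite -pderiveD; [|exact: sfun_diff..].
by apply: (derive_on oD) => // z; exact: sfunD.
Qed.

Lemma sfun_derM i f g : sfun_der i (f * g) = sfun_der i f * g + f * sfun_der i g.
Proof.
apply: sfunP => y Dy; rewrite sfunD// !sfunM// !sfun_derE//.
rewrite [RHS]addrC [X in _ + X]mulrC -pderiveM; [|exact: sfun_diff..].
by apply: (derive_on oD) => // z; exact: sfunM.
Qed.

Lemma sfun_derC i j f : sfun_der i (sfun_der j f) = sfun_der j (sfun_der i f).
Proof.
have e k m y : D y -> sfun_der k (sfun_der m f) y = pderive k (pderive m f) y.
  move=> Dy; rewrite sfun_derE//; apply: (derive_on oD) => // z; exact: sfun_derE.
apply: sfunP => y Dy.
apply: (etrans (e i j y Dy)); apply: (etrans _ (esym (e j i y Dy))).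
have df k : differentiable (pderive k f) y.
  exact: smooth_on_differentiable (smooth_on_pderive _ (sfun_smooth f)) Dy.
have d0 : \forall z \near y, differentiable f z.
  by apply: filterS (open_nbhs_nbhs (conj oD Dy)) => z; exact: sfun_diff.
exact: (derive_comm d0 (df j) (df i)).
Qed.

Lemma sfun_half : sfun_cst 2^-1 + sfun_cst 2^-1 = 1.
Proof.
by apply: sfunP => y Dy; rewrite sfunD// sfun1// !sfun_cstE0// [RHS]splitr mul1r.
Qed.

Definition sdiff : diffring n :=
  @DiffRing n (sfun D) sfun_der sfun_derD sfun_derM sfun_derC _ sfun_half.

End SmoothFunctions.

(** * Evaluation of tensors at a point *)

Section Evaluation.
Context (R : realType) (n : nat) (D : region R n).
Local Notation A := (sdiff D).
Implicit Types (f g : A) (X Y Z : 'rV[A]_n) (y : 'rV[R]_n).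
Let oD := @region_open _ _ D.

Definition ev y (f : A) : R := sfun_val f y.

Lemma evD f g y : D y -> ev y (f + g) = ev y f + ev y g.
Proof. exact: sfunD. Qed.

Lemma evM f g y : D y -> ev y (f * g) = ev y f * ev y g.
Proof. exact: sfunM. Qed.

Lemma evN f y : D y -> ev y (- f) = - ev y f.
Proof. exact: sfunN. Qed.

Lemma evB f g y : D y -> ev y (f - g) = ev y f - ev y g.
Proof. by move=> Dy; rewrite evD// evN. Qed.

Lemma ev0 y : ev y 0 = 0. Proof. exact: sfun0. Qed.

Lemma ev1 y : D y -> ev y 1 = 1. Proof. exact: sfun1. Qed.

Lemma ev_sum (I : Type) (r : seq I) (P : pred I) (F : I -> A) y : D y ->
  ev y (\sum_(i <- r | P i) F i) = \sum_(i <- r | P i) ev y (F i).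
Proof. exact: sfun_sum. Qed.

Lemma ev_der i f y : D y -> ev y (der i f) = pderive i (ev^~ f) y.
Proof. exact: sfun_derE. Qed.

Lemma ev_half y : D y -> ev y (half A) = 2^-1.
Proof. exact: sfun_cstE0. Qed.

Lemma ev_diff f y : D y -> differentiable (ev^~ f) y.
Proof. exact: sfun_diff. Qed.

Lemma ev_inj f g : (forall y, D y -> ev y f = ev y g) -> f = g.
Proof. exact: sfunP. Qed.

Definition evm p q y (X : 'M[A]_(p, q)) : 'M[R]_(p, q) := map_mx (ev y) X.

Lemma evmE p q y (X : 'M[A]_(p, q)) i j : evm y X i j = ev y (X i j).
Proof. by rewrite mxE. Qed.

Lemma evmM p q r y (X : 'M[A]_(p, q)) (Y : 'M[A]_(q, r)) : D y ->
  evm y (X *m Y) = evm y X *m evm y Y.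
Proof.
move=> Dy; apply/matrixP => i j; rewrite evmE !mxE ev_sum//.
by apply: eq_bigr => k _; rewrite evM// !evmE.
Qed.

Lemma evmD p q y (X Y : 'M[A]_(p, q)) : D y -> evm y (X + Y) = evm y X + evm y Y.
Proof. by move=> Dy; apply/matrixP => i j; rewrite !mxE evD. Qed.

Lemma evmB p q y (X Y : 'M[A]_(p, q)) : D y -> evm y (X - Y) = evm y X - evm y Y.
Proof. by move=> Dy; apply/matrixP => i j; rewrite !mxE evB. Qed.

Lemma evmZ p q y a (X : 'M[A]_(p, q)) : D y -> evm y (a *: X) = ev y a *: evm y X.
Proof. by move=> Dy; apply/matrixP => i j; rewrite !mxE evM. Qed.

Lemma evm_tr p q y (X : 'M[A]_(p, q)) : evm y X^T = (evm y X)^T.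
Proof. by apply/matrixP => i j; rewrite !mxE. Qed.

Lemma evm_scalar y m a : evm y (a%:M : 'M[A]_m) = (ev y a)%:M.
Proof.
by apply/matrixP => i j; rewrite !mxE; case: eqP => _; rewrite ?mulr1n ?mulr0n ?ev0.
Qed.

Lemma evm_inj p q (X Y : 'M[A]_(p, q)) : (forall y, D y -> evm y X = evm y Y) -> X = Y.
Proof.
by move=> XY; apply/matrixP => i j; apply: ev_inj => y /XY/matrixP/(_ i j); rewrite !evmE.
Qed.

Lemma ev_smooth f : smooth_on D (fun y => ev y f).
Proof. exact: sfun_smooth. Qed.

Definition elt (F : 'rV[R]_n -> R) (sF : smooth_on D F) : A := sfun_of sF.

Lemma ev_elt F (sF : smooth_on D F) y : D y -> ev y (elt sF) = F y.
Proof. exact: sfun_ofE. Qed.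

Section EvaluationMorphism.
Context (x : 'rV[R]_n) (Dx : D x).

(** Membership of [x] in [D] makes this unital, since elements of the ring vanish outside [D]. *)
Definition ev_at (f : dring A) : R := ev x f.

Fact ev_at_zmod : zmod_morphism ev_at.
Proof. by move=> f g; exact: evB. Qed.

Fact ev_at_monoid : monoid_morphism ev_at.
Proof. by split=> [|f g]; [exact: ev1|exact: evM]. Qed.

HB.instance Definition _ := GRing.isZmodMorphism.Build (dring A) R ev_at ev_at_zmod.
HB.instance Definition _ := GRing.isMonoidMorphism.Build (dring A) R ev_at ev_at_monoid.

Definition ev_morph : {rmorphism dring A -> R} := ev_at.

Lemma ev_morphE f : ev x f = ev_morph f. Proof. by []. Qed.

End EvaluationMorphism.

Definition cst_elt (a : R) : A := sfun_cst D a.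

Lemma ev_cst a y : D y -> ev y (cst_elt a) = a.
Proof. exact: sfun_cstE0. Qed.

(** The constant extensions through which the statement evaluates its tensors. *)
Definition cvec (v : 'rV[R]_n) : 'rV[A]_n := map_mx cst_elt v.

Lemma evm_cvec y v : D y -> evm y (cvec v) = v.
Proof. by move=> Dy; apply/rowP => i; rewrite !mxE ev_cst. Qed.

Lemma cvec_delta i : cvec (delta_mx 0 i) = delta_mx 0 i.
Proof.
apply: evm_inj => y Dy; rewrite evm_cvec//; apply/rowP => j; rewrite !mxE.
by case: (_ && _); rewrite ?ev1 ?ev0.
Qed.

(** The dictionary starts here: functions and fields of the statement only have to agree on [D] with
    evaluations of ring elements, and the analytic operations then become evaluations of the
    algebraic ones. *)
Lemma derive_rep F f v X y : (forall z, D z -> F z = ev z f) -> D y ->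
  v = evm y X -> 'D_v F y = ev y (act X f).
Proof.
move=> Ff Dy ->; rewrite (derive_on oD _ Ff Dy) derive_sum_pderive; last exact: ev_diff.
by rewrite ev_sum//; apply: eq_bigr => i _; rewrite evM// ev_der// evmE.
Qed.

Lemma derive_vrep F v X Y y : (forall z, D z -> F z = evm z Y) -> D y ->
  v = evm y X -> 'D_v F y = evm y (vact X Y).
Proof.
move=> FY Dy vX; rewrite (derive_on oD _ FY Dy) derive_mx; last first.
  apply/derivable_mxP => i j; apply: diff_derivable.
  rewrite (_ : (fun _ => _) = ev^~ (Y i j)); first exact: ev_diff.
  by apply/funext => z; rewrite evmE.
apply/rowP => k; rewrite !mxE; apply: derive_rep => // z Dz.
by rewrite evmE.
Qed.

Lemma bracket_rep F F' X Y y :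
  (forall z, D z -> F z = evm z X) -> (forall z, D z -> F' z = evm z Y) -> D y ->
  bracket F F' y = evm y (br X Y).
Proof.
move=> FX FY Dy; rewrite /bracket br.unlock evmB//.
by rewrite (derive_vrep FY Dy (FX y Dy)) (derive_vrep FX Dy (FY y Dy)).
Qed.

Lemma bilin_evE (T : 'rV[A]_n -> 'rV[A]_n -> A) X Y y : bilin T -> D y ->
  ev y (T X Y) = (evm y X *m (\matrix_(i, j) ev y (T (delta_mx 0 i) (delta_mx 0 j)))
    *m (evm y Y)^T) 0 0.
Proof.
move=> bT Dy; rewrite {1}(row_sum_delta X) {1}(row_sum_delta Y) bilin_on_sum// ev_sum//.
rewrite mxE; under [RHS]eq_bigr do rewrite mxE mulr_suml.
rewrite [RHS]exchange_big /=; apply: eq_bigr => i _; rewrite ev_sum//.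
by apply: eq_bigr => j _; rewrite !evM// !mxE; ring.
Qed.

(** A tensor at a point depends only on the values of its arguments there, so one extension may be
    traded for another. *)
Lemma bilin_ev_local (T : 'rV[A]_n -> 'rV[A]_n -> A) X Y X' Y' y : bilin T -> D y ->
  evm y X = evm y X' -> evm y Y = evm y Y' -> ev y (T X Y) = ev y (T X' Y').
Proof. by move=> bT Dy XX' YY'; rewrite !bilin_evE// XX' YY'. Qed.

Section Geometry.
Context (G : 'rV[R]_n -> 'M[R]_n) (M : dmetric A).
Hypothesis GM : forall z, D z -> G z = evm z (dgram M).

Lemma ip_rep X Y y : D y -> ip (G y) (evm y X) (evm y Y) = ev y (gg M X Y).
Proof. by move=> Dy; rewrite /ip GM// -evm_tr -!evmM// evmE. Qed.

Lemma invmx_rep y : D y -> invmx (G y) = evm y (dgram_inv M).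
Proof.
move=> Dy; have h : G y *m evm y (dgram_inv M) = 1%:M.
  by rewrite GM// -evmM// dgramV evm_scalar ev1.
have [u _] := mulmx1_unit h.
by rewrite -[LHS]mulmx1 -h mulmxA mulVmx// mul1mx.
Qed.

Lemma christoffel_rep y i j k : D y -> christoffel G y i j k = ev y (chr M i j k).
Proof.
have dG z a b : D z -> G z a b = ev z (dgram M a b) by move=> Dz; rewrite GM// evmE.
move=> Dy; rewrite /christoffel /chr evM// ev_half// ev_sum//; congr (_ * _).
apply: eq_bigr => l _; rewrite invmx_rep// evM// evmE; congr (_ * _).
rewrite evB// evD// !ev_der//.
have e a b c : pderive c (fun z => G z a b) y = pderive c (ev^~ (dgram M a b)) y.
  by apply: (derive_on oD) => // z Dz; exact: dG.
by rewrite (e j l i) (e i l j) (e i j l).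
Qed.

Lemma nabla_rep F v X Y y : (forall z, D z -> F z = evm z Y) -> D y ->
  v = evm y X -> nabla G v F y = evm y (nab M X Y).
Proof.
move=> FY Dy vX; rewrite /nabla nab.unlock evmD// (derive_vrep FY Dy vX); congr (_ + _).
apply/rowP => k; rewrite !mxE ev_sum//; apply: eq_bigr => i _.
rewrite ev_sum//; apply: eq_bigr => j _.
by rewrite christoffel_rep// !evM// vX FY// !evmE.
Qed.

Lemma curvature_rep F1 F2 F3 X Y Z y : (forall z, D z -> F1 z = evm z X) ->
  (forall z, D z -> F2 z = evm z Y) -> (forall z, D z -> F3 z = evm z Z) -> D y ->
  curvature G F1 F2 F3 y = evm y (curv M X Y Z).
Proof.
move=> h1 h2 h3 Dy; rewrite /curvature /curv !evmB//.
have n2 z : D z -> nabla G (F2 z) F3 z = evm z (nab M Y Z).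
  by move=> Dz; apply: nabla_rep => //; exact: h2.
have n1 z : D z -> nabla G (F1 z) F3 z = evm z (nab M X Z).
  by move=> Dz; apply: nabla_rep => //; exact: h1.
rewrite (nabla_rep n2 Dy (h1 y Dy)) (nabla_rep n1 Dy (h2 y Dy)).
by rewrite (nabla_rep h3 Dy (bracket_rep h1 h2 Dy)).
Qed.

Let cst_rep v z : D z -> cst v z = evm z (cvec v).
Proof. by move=> Dz; rewrite evm_cvec. Qed.

Let cstE v z : D z -> v = evm z (cvec v).
Proof. by move=> Dz; rewrite evm_cvec. Qed.

Lemma ricci_rep y v w : D y -> ricci G y v w = ev y (ric M (cvec v) (cvec w)).
Proof.
move=> Dy; rewrite /ricci /ric ev_sum//; apply: eq_bigr => k _.
by rewrite (curvature_rep (cst_rep _) (cst_rep v) (cst_rep w) Dy) evmE cvec_delta.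
Qed.

Lemma hessian_rep F f y v w : (forall z, D z -> F z = ev z f) -> D y ->
  hessian G F y v w = ev y (dhess M f (cvec v) (cvec w)).
Proof.
move=> Ff Dy; rewrite /hessian /dhess evB//.
have Dw z : D z -> 'D_w F z = ev z (act (cvec w) f).
  by move=> Dz; apply: derive_rep => //; exact: cstE.
rewrite (derive_rep Dw Dy (cstE v Dy)).
by rewrite (derive_rep Ff Dy (nabla_rep (cst_rep w) Dy (cstE v Dy))).
Qed.

Lemma flat_rep F X y v : (forall z, D z -> F z = evm z X) -> D y ->
  flat G F y v = ev y (gg M X (cvec v)).
Proof. by move=> FX Dy; rewrite /flat FX// {1}(cstE v Dy) ip_rep. Qed.

Lemma mean_curv_rep F X y : (forall z, D z -> F z = evm z X) -> D y ->
  mean_curv G F y = evm y (nab M X X).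
Proof. by move=> FX Dy; apply: nabla_rep => //; exact: FX. Qed.

Lemma lie_metric_rep F X y v w : (forall z, D z -> F z = evm z X) -> D y ->
  lie_metric G F y v w = ev y (dlie M X (cvec v) (cvec w)).
Proof.
move=> FX Dy; rewrite /lie_metric /dlie !evB//.
have gvw z : D z -> ip (G z) v w = ev z (gg M (cvec v) (cvec w)).
  by move=> Dz; rewrite {1}(cstE v Dz) {1}(cstE w Dz) ip_rep.
rewrite (derive_rep gvw Dy (FX y Dy)) !(bracket_rep FX (cst_rep _) Dy).
by rewrite {2}(cstE w Dy) {3}(cstE v Dy) !ip_rep.
Qed.

Lemma domega_rep F X y v w : (forall z, D z -> F z = evm z X) -> D y ->
  domega G F y v w = ev y (dext M X (cvec v) (cvec w)).
Proof.
move=> FX Dy; rewrite /domega /ext_deriv1 /dext !evB//.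
have fl v' z : D z -> flat G F z (cst v' z) = ev z (gg M X (cvec v')).
  by move=> Dz; exact: flat_rep.
rewrite (derive_rep (fl w) Dy (cst_rep v Dy)) (derive_rep (fl v) Dy (cst_rep w Dy)).
by rewrite /flat (bracket_rep (cst_rep v) (cst_rep w) Dy) FX// ip_rep.
Qed.

Lemma nabla_domega_rep F X y z v w : (forall z, D z -> F z = evm z X) -> D y ->
  nabla_form2 G (domega G F) y z v w =
  ev y (dnab2 M (dext M X) (cvec z) (cvec v) (cvec w)).
Proof.
move=> FX Dy; rewrite /nabla_form2 /dnab2 evB// evB//.
have dO y' : D y' -> domega G F y' v w = ev y' (dext M X (cvec v) (cvec w)).
  exact: domega_rep.
rewrite (derive_rep dO Dy (cstE z Dy)) !(domega_rep _ _ FX Dy).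
rewrite !(nabla_rep (cst_rep _) Dy (cstE z Dy)).
have bO := bilin_dext M X.
(* [domega] extends the vector [nabla G z (cst v) y] by a constant field, [dnab2] has the field
   [nab M (cvec z) (cvec v)]; they agree at [y]. *)
rewrite (bilin_ev_local (Y' := cvec w) bO Dy (evm_cvec _ Dy) erefl).
by rewrite (bilin_ev_local (X' := cvec v) bO Dy erefl (evm_cvec _ Dy)).
Qed.

Lemma dvert_rep F X L l y v : (forall z, D z -> F z = evm z X) ->
  (forall z, D z -> L z = ev z l) -> D y ->
  dvert G F L y v = ev y (act X l * gg M X (cvec v)).
Proof.
move=> FX Ll Dy; rewrite /dvert evM// (flat_rep _ FX Dy).
by rewrite (derive_rep Ll Dy (FX y Dy)).
Qed.

End Geometry.
End Evaluation.
Arguments ev {R n D} y f.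

(* Keeps unification from unfolding ring expressions in [sdiff D] into functions. *)
Opaque sdiff ev gg act dext dhess dnab2 dlie ric curv struct conn.

(** * Metrics, logarithms and pullbacks as ring elements *)

Lemma ip_mul (R : realType) n p (B : 'M[R]_n) (P Q : 'M[R]_(p, n)) (a b : 'rV[R]_p) :
  ip B (a *m P) (b *m Q) = (a *m (P *m B *m Q^T) *m b^T) 0 0.
Proof. by rewrite /ip trmx_mul !mulmxA. Qed.

Lemma posdef_unit (R : realType) n (B : 'M[R]_n) :
  (forall v, v != 0 -> 0 < ip B v v) -> B \in unitmx.
Proof.
move=> pos; rewrite unitmxE unitfE; apply/negP => /det0P[v v0 vB].
by have := pos v v0; rewrite /ip vB mul0mx mxE ltxx.
Qed.

Lemma forms_eq (R : realType) n (B C : 'M[R]_n) :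
  (forall a b : 'rV[R]_n, (a *m B *m b^T) 0 0 = (a *m C *m b^T) 0 0) -> B = C.
Proof.
move=> h; apply/matrixP => i j; have := h (delta_mx 0 i) (delta_mx 0 j).
by rewrite trmx_delta -!rowE -!colE !mxE.
Qed.

(** The rows of [P = J^T *m invmx B] are the gradients of the components of phi. They are
    horizontal, and [S = P *m J] is both their Gram matrix and their image. Semi-conformality on
    them reads S C S = L S, and [S] can be cancelled because phi is a submersion. *)
Lemma conformal_gram (R : realType) (m n : nat) (B : 'M[R]_m) (C : 'M[R]_n)
    (J : 'M[R]_(m, n)) (L : R) :
  B^T = B -> (forall v, v != 0 -> 0 < ip B v v) ->
  (forall w : 'rV[R]_n, exists v : 'rV[R]_m, v *m J = w) ->
  (forall v w, horizontal B (mulmxr J) v -> horizontal B (mulmxr J) w ->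
    ip C (v *m J) (w *m J) = L * ip B v w) ->
  J^T *m invmx B *m J *m C = L%:M.
Proof.
move=> Bsym pos surj conf; have uB := posdef_unit pos.
set P := J^T *m invmx B; set S := P *m J.
have PB : P *m B = J^T by rewrite -mulmxA mulVmx// mulmx1.
have hor a : horizontal B (mulmxr J) (a *m P).
  move=> w wJ; rewrite /ip -(mulmxA a) PB -mulmxA -trmx_mul.
  by have -> : w *m J = 0 by []; rewrite trmx0 mulmx0 mxE.
have BP : B *m P^T = J by rewrite -[B in LHS]Bsym -trmx_mul PB trmxK.
have SE : S = P *m B *m P^T by rewrite -mulmxA BP.
have Qsym (Q : 'M[R]_(n, m)) : (Q *m B *m Q^T)^T = Q *m B *m Q^T.
  by rewrite !trmx_mul trmxK Bsym mulmxA.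
have Ssym : S^T = S by rewrite SE Qsym.
have SCS : S *m C *m S = L *: S.
  apply: forms_eq => a b; have := conf _ _ (hor a) (hor b).
  rewrite -!(mulmxA _ P J) -/S ip_mul Ssym ip_mul -SE => ->.
  by rewrite -scalemxAr -scalemxAl [RHS]mxE.
have uS : S \in unitmx.
  rewrite unitmxE unitfE; apply/negP => /det0P[a a0 aS].
  have aP : a *m P = 0.
    apply: contraTeq isT => /pos; rewrite ip_mul -SE aS mul0mx mxE ltxx.
    by [].
  have [v va] := surj a.
  (* With [a = v *m J] this product is [a *m P *m B *m v^T], and its entry is a sum of squares. *)
  have : a *m a^T = 0 by rewrite -{2}va trmx_mul mulmxA -PB mulmxA aP !mul0mx.
  move=> /matrixP/(_ 0 0); rewrite !mxE => /eqP.
  rewrite psumr_eq0 => [/allP h|k _]; last by rewrite mxE -expr2 sqr_ge0.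
  case/eqP: a0; apply/rowP => k; have := h k (mem_index_enum _).
  by rewrite mxE -expr2 sqrf_eq0 => /eqP ->; rewrite mxE.
by rewrite -[LHS](mulmxK uS) SCS -scalemxAl mulmxV// scalemx1.
Qed.

Section Elements.
Context (R : realType) (n : nat) (D : region R n).
Local Notation A := (sdiff D).
Let oD := @region_open _ _ D.
Implicit Types (f g : A).

Lemma smooth_onT k (F : 'rV[R]_n -> R) : smooth_on D F -> Ck_on D k F.
Proof. by move=> h; exact: (smooth_onP _ _).1. Qed.

Lemma exists_inv f : (forall y, D y -> ev y f != 0) -> exists g : A, f * g = 1.
Proof.
move=> f0; have sf : smooth_on D (fun y => (ev y f)^-1).
  apply/smooth_onP => k; apply: Ck_on_inv => //.
  exact/smooth_onT/ev_smooth.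
exists (elt sf); apply: ev_inj => y Dy.
by rewrite evM// ev_elt// ev1// mulfV// f0.
Qed.

Lemma exists_sqrt f : (forall y, D y -> 0 < ev y f) ->
  exists2 g : A, g * g = f & forall y, D y -> 0 < ev y g.
Proof.
move=> f0; have sf : smooth_on D (Num.sqrt \o (ev^~ f)).
  apply/smooth_onP => k; apply: Ck_on_sqrt => //.
  exact/smooth_onT/ev_smooth.
exists (elt sf) => [|y Dy]; last by rewrite ev_elt//= sqrtr_gt0 f0.
apply: ev_inj => y Dy.
by rewrite evM// ev_elt//= -expr2 sqr_sqrtr// ltW// f0.
Qed.

Lemma exists_ln f : (forall y, D y -> 0 < ev y f) ->
  exists2 l : A, forall i, der i f = f * der i l & forall y, D y -> ev y l = ln (ev y f).
Proof.
move=> f0; have sf : smooth_on D (@ln R \o (ev^~ f)).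
  apply/smooth_onP => k; apply: Ck_on_ln => //.
  exact/smooth_onT/ev_smooth.
exists (elt sf) => [i|y Dy]; last by rewrite ev_elt.
apply: ev_inj => y Dy; rewrite evM// !ev_der// /pderive.
rewrite [in RHS](derive_on oD (g := @ln R \o (ev^~ f)) _ _ Dy); last by move=> z Dz; exact: ev_elt.
rewrite (derive_comp1 _ (ev_diff _ Dy) (is_derive1_ln (f0 _ Dy))).2.
by rewrite mulrA mulfV ?mul1r// gt_eqF ?f0.
Qed.

Lemma exists_vec m p (F : 'rV[R]_n -> 'M[R]_(m, p)) : smooth_on D F ->
  exists X : 'M[A]_(m, p), forall y, D y -> F y = evm y X.
Proof.
move=> sF; exists (\matrix_(i, j) elt (smooth_on_coord oD i j sF)) => y Dy.
by apply/matrixP => i j; rewrite !mxE ev_elt.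
Qed.

Lemma evm_det m y (X : 'M[A]_m) : D y -> ev y (\det X) = \det (evm y X).
Proof.
move=> Dy; rewrite /determinant ev_sum//; apply: eq_bigr => s _.
rewrite evM//; congr (_ * _).
  by case: (perm.odd_perm s); rewrite ?expr1 ?expr0 ?evN// ev1.
rewrite (big_morph (ev y) (fun f g => evM f g Dy) (ev1 Dy)).
by apply: eq_bigr => i _; rewrite evmE.
Qed.

(** Positivity makes the determinant invertible in the ring; the adjugate then gives an inverse with
    smooth entries. *)
Lemma exists_metric (G : 'rV[R]_n -> 'M[R]_n) : smooth_on D G ->
  (forall y, D y -> (G y)^T = G y) ->
  (forall y, D y -> forall v, v != 0 -> 0 < ip (G y) v v) ->
  exists M : dmetric A, forall y, D y -> G y = evm y (dgram M).
Proof.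
move=> sG symG posG; have [X GX] := exists_vec sG.
have [y Dy|g Xg] := exists_inv (f := \det X).
  rewrite evm_det// -GX//; have := posdef_unit (posG y Dy).
  by rewrite unitmxE unitfE.
have XT : X^T = X by apply: evm_inj => y Dy; rewrite evm_tr -GX// symG.
have XV : X *m (g *: \adj X) = 1%:M.
  by rewrite -scalemxAr mul_mx_adj scale_scalar_mx mulrC Xg.
by exists (DMetric XT XV).
Qed.

End Elements.

Section Pullback.
Context (R : realType) (m n : nat) (D : region R m) (D' : region R n).
Context (Phi : 'rV[R]_m -> 'rV[R]_n) (sPhi : smooth_on D Phi).
Context (DD' : forall y, D y -> D' (Phi y)).
Local Notation A := (sdiff D).
Local Notation B := (sdiff D').

Definition pull (f : B) : A :=
  elt (smooth_on_comp (@region_open _ _ D) DD' sPhi (ev_smooth f)).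

Lemma ev_pull f y : D y -> ev y (pull f) = ev (Phi y) f.
Proof. by move=> Dy; rewrite ev_elt. Qed.

Fact pull_is_zmod : zmod_morphism (pull : dring B -> dring A).
Proof.
by move=> f g; apply: ev_inj => y Dy; rewrite evB// !ev_pull// evB//; exact: DD'.
Qed.

Fact pull_is_monoid : monoid_morphism (pull : dring B -> dring A).
Proof.
split=> [|f g]; apply: ev_inj => y Dy.
  by rewrite ev_pull// !ev1//; exact: DD'.
by rewrite evM// !ev_pull// evM//; exact: DD'.
Qed.

HB.instance Definition _ := GRing.isZmodMorphism.Build (dring B) (dring A) pull pull_is_zmod.
HB.instance Definition _ := GRing.isMonoidMorphism.Build (dring B) (dring A) pull pull_is_monoid.

Definition pullback : {rmorphism dring B -> dring A} := pull.

Definition coord_elt (c : 'I_n) : A := elt (smooth_on_coord (@region_open _ _ D) 0 c sPhi).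

Lemma ev_der_coord i c y : D y -> ev y (der i (coord_elt c)) = ('d Phi y (delta_mx 0 i)) 0 c.
Proof.
move=> Dy; have dPhi := smooth_on_differentiable sPhi Dy.
rewrite ev_der// -deriveE// derive_mxE// /pderive.
by apply: (derive_on (@region_open _ _ D)) => // z Dz; exact: ev_elt.
Qed.

Lemma pullback_chain i f :
  der i (pullback f) = \sum_c der i (coord_elt c) * pullback (der c f).
Proof.
apply: ev_inj => y Dy; rewrite ev_sum// ev_der// /pderive.
rewrite (derive_on (@region_open _ _ D) (g := ev^~ f \o Phi) _ _ Dy); last first.
  by move=> z Dz; rewrite [LHS]ev_pull.
have dPhi := smooth_on_differentiable sPhi Dy.
rewrite derive_comp//; last exact/ev_diff/DD'.
apply: eq_bigr => c _; rewrite evM// [ev y (pullback _)]ev_pull// (ev_der c f (DD' Dy)).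
by rewrite ev_der_coord// -deriveE// derive_mxE.
Qed.

End Pullback.

(** * Curvature, traces and the integrability tensor at a point *)

Lemma ip_delta (R : realType) n (B : 'M[R]_n) i j :
  ip B (delta_mx 0 i) (delta_mx 0 j) = B i j.
Proof. by rewrite /ip trmx_delta -rowE -colE !mxE. Qed.

Lemma ipZ (R : realType) n (B : 'M[R]_n) a b v w :
  ip B (a *: v) (b *: w) = a * b * ip B v w.
Proof. by rewrite /ip linearZ /= -!scalemxAl -scalemxAr mxE [X in _ * X]mxE mulrA. Qed.

Lemma posdef2 (R : realType) (B : 'M[R]_2) : B^T = B ->
  (forall v, v != 0 -> 0 < ip B v v) ->
  0 < B p0 p0 /\ 0 < B p0 p0 * B p1 p1 - B p0 p1 ^+ 2.
Proof.
move=> symB pos.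
have B10 : B p1 p0 = B p0 p1 by rewrite -[in LHS]symB mxE.
have ipE v w : ip B v w = v 0 p0 * (B p0 p0 * w 0 p0 + B p0 p1 * w 0 p1)
    + v 0 p1 * (B p0 p1 * w 0 p0 + B p1 p1 * w 0 p1).
  by rewrite /ip mxE sum2 !mxE !sum2 B10; ring.
have B00 : 0 < B p0 p0.
  rewrite -ip_delta; apply: pos; apply/eqP => /rowP/(_ p0)/eqP.
  by rewrite !mxE !eqxx oner_eq0.
(* [v] is orthogonal to the first basis vector, and its square norm is [B p0 p0] times the
   determinant. *)
split=> //; pose v : 'rV[R]_2 := B p0 p0 *: delta_mx 0 p1 - B p0 p1 *: delta_mx 0 p0.
have v0E : v 0 p0 = - B p0 p1 by rewrite !mxE /= mulr0 mulr1 sub0r.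
have v1E : v 0 p1 = B p0 p0 by rewrite !mxE /= mulr0 mulr1 subr0.
have v0 : v != 0.
  by apply/eqP => /rowP/(_ p1); rewrite v1E mxE => /eqP; rewrite gt_eqF.
have := pos v v0; rewrite ipE v0E v1E.
have -> : - B p0 p1 * (B p0 p0 * - B p0 p1 + B p0 p1 * B p0 p0) +
  B p0 p0 * (B p0 p1 * - B p0 p1 + B p1 p1 * B p0 p0) =
  B p0 p0 * (B p0 p0 * B p1 p1 - B p0 p1 ^+ 2) by ring.
by rewrite pmulr_rgt0.
Qed.

Section SurfaceElements.
Context (R : realType) (D : region R 2) (H : 'rV[R]_2 -> 'M[R]_2) (M : dmetric (sdiff D)).
Hypothesis HM : forall z, D z -> H z = evm z (dgram M).
Hypothesis symH : forall z, D z -> (H z)^T = H z.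
Hypothesis posH : forall z, D z -> forall v, v != 0 -> 0 < ip (H z) v v.
Local Notation B := (sdiff D).

Lemma exists_invsqrt (f : B) : (forall y, D y -> 0 < ev y f) ->
  exists r : B, r * r * f = 1.
Proof.
move=> f0; have [s ss s0] := exists_sqrt f0.
have [|r sr] := @exists_inv _ _ _ s; first by move=> y /s0/lt0r_neq0.
by exists r; rewrite -ss mulrACA [r * s]mulrC sr mulr1.
Qed.

Lemma exists_orthonormal_frame :
  exists F : 'I_2 -> 'rV[B]_2, forall i j, gg M (F i) (F j) = (i == j)%:R.
Proof.
pose h i j := dgram M i j.
have hE y i j : D y -> ev y (h i j) = H y i j by move=> Dy; rewrite HM// evmE.
have [y Dy|r1 r1E] := @exists_invsqrt (h p0 p0).
  by rewrite hE//; exact: (posdef2 (symH Dy) (posH Dy)).1.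
(* Gram-Schmidt on the coordinate fields with denominators cleared: this is the square norm of the
   second vector before normalisation. *)
have [y Dy|r2 r2E] := @exists_invsqrt (h p0 p0 * (h p0 p0 * h p1 p1 - h p0 p1 * h p0 p1)).
  rewrite evM// evB// !evM// !hE// -expr2.
  by have [? ?] := posdef2 (symH Dy) (posH Dy); exact: mulr_gt0.
pose F (i : 'I_2) : 'rV[B]_2 := if i == p0 then r1 *: delta_mx 0 p0 else
  r2 *: (h p0 p0 *: delta_mx 0 p1 - h p0 p1 *: delta_mx 0 p0).
exists F; have h10 : h p1 p0 = h p0 p1 by exact: dgramE.
do 2!apply: ord2P; rewrite /F /= !(ggDl, ggDr, ggNl, ggNr, ggZl, ggZr) !gg_delta
  -!/(h _ _) ?h10.
- by rewrite -[RHS]r1E; ring.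
- by ring.
- by ring.
- by rewrite -[RHS]r2E; ring.
Qed.

Lemma gauss_curvature_rep F y : (forall i j, gg M (F i) (F j) = (i == j)%:R) -> D y ->
  gauss_curvature H y = ev y (surface_curv M F).
Proof.
move=> onF Dy; rewrite /gauss_curvature /sectional.
have cr v z : D z -> cst v z = evm z (cvec D v) by move=> Dz; rewrite evm_cvec.
have -> : (0 : 'I_2) = p0 by apply: val_inj.
have -> : (1 : 'I_2) = p1 by apply: val_inj.
rewrite (curvature_rep HM (cr _) (cr _) (cr _) Dy).
rewrite -{2}(evm_cvec (delta_mx 0 p0) Dy) (ip_rep HM)// (gg_curv_surface onF) evM//.
rewrite !ip_delta !cvec_delta !gg_delta; move: (surface_curv M F) => K.
have hE i j : ev y (dgram M i j) = H y i j by rewrite HM// evmE.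
rewrite evB// expr2 !evM// !hE -expr2 mulfK// gt_eqF//.
exact: (posdef2 (symH Dy) (posH Dy)).2.
Qed.

End SurfaceElements.

Section Traces.
Context (R : realType) (n : nat) (D : region R n).
Context (G : 'rV[R]_n -> 'M[R]_n) (M : dmetric (sdiff D)).
Hypothesis GM : forall z, D z -> G z = evm z (dgram M).
Local Notation A := (sdiff D).
Context (E : 'I_n -> 'rV[A]_n) (onE : forall i j, gg M (E i) (E j) = (i == j)%:R).
Context (x : 'rV[R]_n) (Dx : D x).

Lemma evm_frame i j : (evm x (E i) *m G x *m (evm x (E j))^T) 0 0 = (i == j)%:R.
Proof.
rewrite -/(ip _ _ _) (ip_rep GM)// onE.
by case: (i == j); rewrite ?ev1 ?ev0.
Qed.

(** [f] is orthonormal at [x] only, [E] on all of [D]; at [x] both sums are traces of the same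
    form. *)
Lemma bilin_trace_rep (f : 'I_n -> 'rV[R]_n) (T : 'rV[A]_n -> 'rV[A]_n -> A) :
  orthonormal_family (G x) f -> bilin T ->
  \sum_i ev x (T (cvec D (f i)) (cvec D (f i))) = ev x (\sum_i T (E i) (E i)).
Proof.
move=> onf bT; rewrite ev_sum//.
rewrite (eq_bigr _ (fun i _ => bilin_evE _ _ bT Dx)).
rewrite [RHS](eq_bigr _ (fun i _ => bilin_evE _ _ bT Dx)).
under eq_bigr do rewrite evm_cvec//.
exact: (trace_frame_independent _ onf evm_frame).
Qed.

Lemma laplacian_rep f L (l : A) : orthonormal_family (G x) f ->
  (forall z, D z -> L z = ev z l) ->
  laplacian G f L x = ev x (\sum_i dhess M l (E i) (E i)).
Proof.
move=> onf Ll; rewrite -(bilin_trace_rep onf (bilin_dhess M l)).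
by apply: eq_bigr => i _; rewrite (hessian_rep GM _ _ Ll Dx).
Qed.

Lemma codiff2_rep f F U v : orthonormal_family (G x) f ->
  (forall z, D z -> F z = evm z U) ->
  codiff2 G f (domega G F) x v =
    - ev x (\sum_i dnab2 M (dext M U) (E i) (E i) (cvec D v)).
Proof.
move=> onf FU; rewrite /codiff2; congr (- _).
have bT : bilin (fun Z X => dnab2 M (dext M U) Z X (cvec D v)).
  split=> [Y|X]; first exact: dnab2_lin1 (bilin_dext M U).
  exact: (bilin_dnab2 M X (bilin_dext M U)).1.
rewrite -(bilin_trace_rep onf bT); apply: eq_bigr => i _.
by rewrite (nabla_domega_rep GM _ _ _ FU Dx).
Qed.

End Traces.

Section Integrability.
Context (R : realType) (D : region R 3).
Context (G : 'rV[R]_3 -> 'M[R]_3) (M : dmetric (sdiff D)).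
Hypothesis GM : forall z, D z -> G z = evm z (dgram M).
Local Notation A := (sdiff D).
Context (E : 'I_3 -> 'rV[A]_3) (onE : forall i j, gg M (E i) (E j) = (i == j)%:R).
Context (u : 'rV[R]_3 -> 'rV[R]_3) (uE : forall z, D z -> u z = evm z (E o2)).
Context (x : 'rV[R]_3) (Dx : D x).
Local Notation U := (E o2).

(** For horizontal fields d theta (X, Y) = - theta [X, Y], so I is - Omega times [u]. Tensoriality
    of Omega replaces the projected extensions by constant ones. *)
Lemma integrability_rep v w : ip (G x) (u x) v = 0 -> ip (G x) (u x) w = 0 ->
  integrability G u x v w = - ev x (dext M U (cvec D v) (cvec D w)) *: u x.
Proof.
move=> uv uw.
pose Hv v' : 'rV[A]_3 := cvec D v' - gg M U (cvec D v') *: U.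
have hr v' z : D z -> hproj G u z v' = evm z (Hv v').
  move=> Dz; rewrite /hproj /vproj (flat_rep GM v' uE Dz) /Hv evmB// evmZ// evm_cvec//.
  by rewrite -uE.
have gH v' : gg M U (Hv v') = 0.
  by rewrite /Hv ggDr ggNr ggZr onE eqxx mulr1 subrr.
have HvE v' : ip (G x) (u x) v' = 0 -> evm x (Hv v') = evm x (cvec D v').
  move=> uv'; rewrite /Hv evmB// evmZ// evm_cvec//.
  by have := flat_rep GM v' uE Dx; rewrite /flat uv' => <-; rewrite scale0r subr0.
rewrite /integrability /vproj (bracket_rep (hr v) (hr w) Dx) /flat; congr (_ *: _).
rewrite {1}(uE Dx) (ip_rep GM)//.
have -> : gg M U (br (Hv v) (Hv w)) = - dext M U (Hv v) (Hv w).
  by rewrite (dext_horizontal (gH v) (gH w)) opprK.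
by rewrite (evN _ Dx) (bilin_ev_local (bilin_dext M U) Dx (HvE v uv) (HvE w uw)).
Qed.

Lemma normI2_rep (e : 'I_2 -> 'rV[R]_3) : orthonormal_family (G x) e ->
  (forall a, ip (G x) (u x) (e a) = 0) ->
  normI2 G u e x = 2 * ev x (struct M E o0 o1 o2) ^+ 2.
Proof.
move=> one eu.
pose phi := ev_morph Dx.
pose C a (i : 'I_3) := phi (gg M (cvec D (e a)) (E i)).
have C2 a : C a o2 = 0.
  by rewrite /C ggC /phi -ev_morphE -(ip_rep GM _ _ Dx) -(uE Dx) (evm_cvec _ Dx) eu.
have CC a b : C a o0 * C b o0 + C a o1 * C b o1 = (a == b)%:R.
  rewrite -one -(gg_eval_horizontal onE _ (C2 a)) /phi -ev_morphE -(ip_rep GM _ _ Dx).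
  by rewrite !(evm_cvec _ Dx).
have uu : ip (G x) (u x) (u x) = 1 by rewrite (uE Dx) (ip_rep GM _ _ Dx) onE (ev1 Dx).
have Iab a b : ev x (dext M U (cvec D (e a)) (cvec D (e b))) =
    - (ev x (struct M E o0 o1 o2) * (C a o0 * C b o1 - C a o1 * C b o0)).
  exact: (dext_eval_horizontal onE (C2 a) (C2 b)).
clearbody C; move: (ev x (struct M E o0 o1 o2)) Iab => s Iab.
have IIab a b : ip (G x) (integrability G u x (e a) (e b)) (integrability G u x (e a) (e b))
    = s ^+ 2 * (C a o0 * C b o1 - C a o1 * C b o0) ^+ 2.
  by rewrite integrability_rep// ipZ uu mulr1 (Iab a b); ring.
have -> : normI2 G u e x =
    \sum_a \sum_b s ^+ 2 * (C a o0 * C b o1 - C a o1 * C b o0) ^+ 2.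
  by apply: eq_bigr => a _; apply: eq_bigr => b _; exact: IIab.
clear IIab Iab; rewrite sum2 !sum2.
have h00 := CC p0 p0; have h01 := CC p0 p1; have h11 := CC p1 p1.
(* Lagrange identity: the horizontal frames differ by an orthogonal matrix, whose determinant has
   square 1. Both orders of the pair contribute, hence the factor 2. *)
have dd : (C p0 o0 * C p1 o1 - C p0 o1 * C p1 o0) ^+ 2 = 1.
  transitivity ((C p0 o0 * C p0 o0 + C p0 o1 * C p0 o1) *
    (C p1 o0 * C p1 o0 + C p1 o1 * C p1 o1)
    - (C p0 o0 * C p1 o0 + C p0 o1 * C p1 o1) ^+ 2); first by ring.
  by rewrite h00 h01 h11 /=; ring.
have dd' : (C p1 o0 * C p0 o1 - C p1 o1 * C p0 o0) ^+ 2 = 1 by rewrite -dd; ring.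
by rewrite dd dd'; ring.
Qed.

End Integrability.

(** * The formula in a chart *)

(** Halves the evaluated identity; [s] is the value of 2w, and [2 * s ^+ 2] is ||I||^2. *)
Lemma ricci_arith (R : realFieldType) (r k lap muL g tX tY s li mX mY a dX dY cX cY : R) :
  r *+ 2 = (k + lap + muL) *+ 2 * (g - tX * tY) - s * s * g + li
    - (mX + a * tX) * (mY + a * tY) *+ 2 - (a * tX) * (a * tY) *+ 2
    + (dX * tY + dY * tX) *+ 2 + (cX * tY + cY * tX) ->
  r = (k + lap + muL) * (g - tX * tY) - 4^-1 * (2 * s ^+ 2) * g + 2^-1 * li
    - (mX + a * tX) * (mY + a * tY) - (a * tX) * (a * tY)
    + 2 * (2^-1 * (dX * tY + tX * dY)) + 2^-1 * (cX * tY + tX * cY).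
Proof. by move=> h; lra. Qed.

Section LocalFormula.
Context (R : realType) (D : region R 3) (D' : region R 2).
Context (G : 'rV[R]_3 -> 'M[R]_3) (H : 'rV[R]_2 -> 'M[R]_2).
Context (Phi : 'rV[R]_3 -> 'rV[R]_2) (u : 'rV[R]_3 -> 'rV[R]_3) (Lam : 'rV[R]_3 -> R).
Hypothesis sG : smooth_on D G.
Hypothesis symG : forall y, D y -> (G y)^T = G y.
Hypothesis posG : forall y, D y -> forall v, v != 0 -> 0 < ip (G y) v v.
Hypothesis sH : smooth_on D' H.
Hypothesis symH : forall z, D' z -> (H z)^T = H z.
Hypothesis posH : forall z, D' z -> forall v, v != 0 -> 0 < ip (H z) v v.
Hypothesis sPhi : smooth_on D Phi.
Hypothesis DD' : forall y, D y -> D' (Phi y).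
Hypothesis surj : forall y, D y -> forall w, exists v, 'd Phi y v = w.
Hypothesis Lam0 : forall y, D y -> 0 < Lam y.
Hypothesis conf : forall y, D y -> forall v w, horizontal (G y) ('d Phi y) v ->
  horizontal (G y) ('d Phi y) w ->
  ip (H (Phi y)) ('d Phi y v) ('d Phi y w) = Lam y ^+ 2 * ip (G y) v w.
Hypothesis su : smooth_on D u.
Hypothesis uvert : forall y, D y -> 'd Phi y (u y) = 0.
Hypothesis uunit : forall y, D y -> ip (G y) (u y) (u y) = 1.
Local Notation A := (sdiff D).
Local Notation pb := (pullback sPhi DD').
Let oD := @region_open _ _ D.
Let J : 'M[A]_(3, 2) := \matrix_(i, c) der i (coord_elt sPhi c).

Lemma diff_jacobian y v : D y -> 'd Phi y v = v *m evm y J.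
Proof.
move=> Dy; rewrite [in LHS](row_sum_delta v) linear_sum mulmx_sum_row.
apply: eq_bigr => i _; rewrite linearZ; congr (_ *: _).
by apply/rowP => c; rewrite !mxE ev_der_coord.
Qed.

Lemma local_conformal (M : dmetric A) (N : dmetric (sdiff D')) y :
  (forall y, D y -> G y = evm y (dgram M)) -> (forall z, D' z -> H z = evm z (dgram N)) ->
  D y -> evm y (J^T *m dgram_inv M *m J *m map_mx pb (dgram N)) = (Lam y ^+ 2)%:M.
Proof.
move=> GM HN Dy; rewrite !evmM// evm_tr -(invmx_rep GM)//.
have -> : evm y (map_mx pb (dgram N)) = H (Phi y).
  rewrite HN; last exact: DD'.
  by apply/matrixP => i j; rewrite !mxE ev_pull.
have dJ : 'd Phi y = mulmxr (evm y J) :> (_ -> _).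
  by apply/funext => v; rewrite diff_jacobian.
apply: conformal_gram (symG Dy) (posG Dy) _ _.
  by move=> w; have [v vw] := surj Dy w; exists v; rewrite -diff_jacobian.
move=> v w hv hw; rewrite -!diff_jacobian//; apply: conf => //.
  by rewrite dJ.
by rewrite dJ.
Qed.

Theorem local_ricci_formula (x : 'rV[R]_3) (Dx : D x) (lnl : 'rV[R]_3 -> R)
  (lnlE : forall y, D y -> lnl y = ln (Lam y))
  (f : 'I_3 -> 'rV[R]_3) (onf : orthonormal_family (G x) f)
  (e : 'I_2 -> 'rV[R]_3) (one : orthonormal_family (G x) e)
  (hor : forall a, horizontal (G x) ('d Phi x) (e a)) (X Y : 'rV[R]_3) :
  let mu := mean_curv G u in
  let theta := flat G u x in
  let KN := gauss_curvature H (Phi x) in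
  let dVlnl := dvert G u lnl x in
  let muflat_dVlnl := fun v : 'rV[R]_3 => flat G mu x v + dVlnl v in
  let dUlnl := fun v : 'rV[R]_3 => 'D_v (fun y => 'D_(u y) lnl y) x in
  let dstarOmega := codiff2 G f (domega G u) x in
  ricci G x X Y =
    (Lam x ^+ 2 * KN + laplacian G f lnl x + 'D_(mu x) lnl x)
      * (ip (G x) X Y - theta X * theta Y)
    - 4^-1 * normI2 G u e x * ip (G x) X Y
    + 2^-1 * lie_metric G mu x X Y
    - muflat_dVlnl X * muflat_dVlnl Y
    - dVlnl X * dVlnl Y
    + 2 * symprod dUlnl theta X Y
    + symprod dstarOmega theta X Y.
Proof.
have [M GM] := exists_metric sG symG posG.
have [N HN] := exists_metric sH symH posH.
have [U uE] := exists_vec su.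
have [F onF] := exists_orthonormal_frame HN symH posH.
(* Smoothness of the dilation comes from here: its square is a diagonal entry of a product of
   matrices over the ring, and [lam] is the positive square root. *)
pose lam2 : A := (J^T *m dgram_inv M *m J *m map_mx pb (dgram N)) p0 p0.
have lam2E y : D y -> ev y lam2 = Lam y ^+ 2.
  move=> Dy; rewrite /lam2 -evmE (local_conformal GM HN Dy).
  by rewrite mxE eqxx mulr1n.
have lam2_gt0 y : D y -> 0 < ev y lam2.
  by move=> Dy; rewrite lam2E// exprn_gt0// Lam0.
have [lam lamlam lam_gt0] := exists_sqrt lam2_gt0.
have [lami lamK] : exists lami : A, lam * lami = 1.
  by apply: exists_inv => y /lam_gt0/lt0r_neq0.
have lamE y : D y -> ev y lam = Lam y.
  move=> Dy; have /eqP := lam2E y Dy; rewrite -lamlam evM// -expr2.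
  by rewrite eqrXn2 ?ltW ?lam_gt0 ?Lam0// => /eqP.
have [l der_lam lE] := exists_ln lam_gt0.
have lnl_rep y : D y -> lnl y = ev y l by move=> Dy; rewrite lnlE// lE// lamE.
have UU : gg M U U = 1.
  by apply: ev_inj => y Dy; rewrite -(ip_rep GM)// -uE// uunit// ev1.
have UJ : U *m J = 0.
  apply: evm_inj => y Dy; rewrite evmM// -uE// -diff_jacobian// uvert//.
  by apply/rowP => c; rewrite !mxE ev0.
have lam_conf : J^T *m dgram_inv M *m J *m map_mx pb (dgram N) = (lam ^+ 2)%:M.
  apply: evm_inj => y Dy; rewrite (local_conformal GM HN Dy) evm_scalar.
  by rewrite !expr2 evM// lamE.
set E := adapted_frame pb (coord_elt sPhi) M N U lam lami F.
have onE : forall i j, gg M (E i) (E j) = (i == j)%:R.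
  exact: (adapted_on UU UJ lamK lam_conf onF).
have Eu : E o2 = U by [].
have uE2 : forall z, D z -> u z = evm z (E o2) by rewrite Eu.
have main := ric_submersion (pullback_chain sPhi DD') UU UJ lamK der_lam lam_conf onF
  (cvec D X) (cvec D Y).
have hs := horizontal_struct pb (coord_elt sPhi) M N U lam lami F.
rewrite -/E in main hs.
move=> mu theta KN dVlnl muflat_dVlnl dUlnl dstarOmega.
have thE v : theta v = ev x (gg M (E o2) (cvec D v)) := flat_rep GM v uE2 Dx.
have muE z : D z -> mu z = evm z (mu3 M E).
  by move=> Dz; exact: (mean_curv_rep GM uE2 Dz).
have mufE v : flat G mu x v = ev x (gg M (mu3 M E) (cvec D v)) := flat_rep GM v muE Dx.
have dVE v : dVlnl v = ev x (act U l) * theta v.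
  rewrite thE -(evM _ _ Dx); exact: (dvert_rep GM v uE lnl_rep Dx).
have cE v : v = evm x (cvec D v) by rewrite (evm_cvec _ Dx).
have UlE z : D z -> 'D_(u z) lnl z = ev z (act U l).
  by move=> Dz; exact: (derive_rep lnl_rep Dz (uE z Dz)).
have dUE v : dUlnl v = ev x (act (cvec D v) (act U l)).
  exact: (derive_rep UlE Dx (cE v)).
have dsE v : dstarOmega v = ev x (codiff3 M E (cvec D v)).
  rewrite /codiff3 (evN _ Dx); exact: (codiff2_rep GM onE Dx v onf uE2).
have KE : ev x (lam ^+ 2 * pb (surface_curv N F)) = Lam x ^+ 2 * KN.
  rewrite (evM _ _ Dx) expr2 (evM _ _ Dx) (lamE _ Dx) -expr2; congr (_ * _).
  by rewrite /KN (gauss_curvature_rep HN symH posH onF (DD' Dx)); exact: ev_pull.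
have lapE : laplacian G f lnl x = ev x (lap3 M E l).
  exact: (laplacian_rep GM onE Dx onf lnl_rep).
have muLE : 'D_(mu x) lnl x = ev x (act (mu3 M E) l).
  exact: (derive_rep lnl_rep Dx (muE x Dx)).
have eu a : ip (G x) (u x) (e a) = 0.
  rewrite (cE (e a)) (uE _ Dx) (ip_rep GM _ _ Dx) ggC -(ip_rep GM _ _ Dx) -(uE _ Dx).
  by rewrite -(cE (e a)); exact: hor (uvert Dx).
have IE := normI2_rep GM onE uE2 Dx one eu.
have lieE := lie_metric_rep GM X Y muE Dx.
have ipE : ip (G x) X Y = ev x (gg M (cvec D X) (cvec D Y)).
  by rewrite {1}(cE X) {1}(cE Y) (ip_rep GM _ _ Dx).
have h := congr1 (ev_morph Dx) main.
rewrite ric_rhs_eval -hs rmorphMn in h.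
rewrite IE /muflat_dVlnl /symprod.
clearbody KN theta dVlnl dUlnl dstarOmega.
rewrite -KE (ricci_rep GM X Y Dx) lapE muLE lieE ipE !dVE !mufE !thE !dUE !dsE.
exact: (ricci_arith h).
Qed.

End LocalFormula.

(** * Passage from charts to the manifolds *)

Lemma chart_image_open (R : realType) n (T : topologicalType) (c : chart R n T)
    (V : set T) : open V -> open (chart_map c @` (chart_dom c `&` V)).
Proof.
move=> oV; rewrite openE => _ [q [cq Vq] <-].
have cont := chart_inv_continuous (c := c).
rewrite continuous_open_subspace in cont; last exact: chart_cod_open.
have cy : (chart_map c @` chart_dom c) (chart_map c q) by exists q.
have /= := cont _ (mem_set cy); rewrite /continuous_at chart_mapK// => cvq.
have nV : nbhs (chart_map c q) (chart_inv c @^-1` V).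
  by apply: cvq; exact: open_nbhs_nbhs.
have nC := open_nbhs_nbhs (conj (chart_cod_open (c := c)) cy).
apply: filterS (filterI nV nC) => y [Vy [z cz zy]].
by exists z => //; split=> //; move: Vy; rewrite /= -zy chart_mapK.
Qed.

Theorem proposition2p1 (R : realType) (M : manifold R 3) (N : manifold R 2)
  (g : riemannian M) (h : riemannian N) (phi : M -> N) (lambda : M -> R)
  (phi_submersion : submersion phi)
  (phi_semiconformal : semiconformal g h phi lambda)
  (W : set M) (W_open : open W)
  (U : vector_field W) (U_unit_vertical : unit_vertical g phi U)
  (p : M) (Wp : W p)
  (c : charts M) (cp : chart_dom c p)
  (d : charts N) (dp : chart_dom d (phi p))
  (f : 'I_3 -> 'rV[R]_3) (f_frame : orthonormal_family (g c (chart_map c p)) f)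
  (e : 'I_2 -> 'rV[R]_3) (e_frame : orthonormal_family (g c (chart_map c p)) e)
  (e_horizontal : forall a : 'I_2,
     horizontal (g c (chart_map c p)) (tangent_map phi c d p) (e a))
  (X Y : 'rV[R]_3) :
  let x := chart_map c p in
  let G := g c in
  let u := U c in
  let mu := mean_curv G u in
  let theta := flat G u x in
  let KN := gauss_curvature (h d) (chart_map d (phi p)) in
  let lnl := fun y : 'rV[R]_3 => ln (lambda (chart_inv c y)) in
  let dVlnl := dvert G u lnl x in
  let muflat_dVlnl := fun v : 'rV[R]_3 => flat G mu x v + dVlnl v in
  let dUlnl := fun v : 'rV[R]_3 => 'D_v (fun y => 'D_(u y) lnl y) x in
  let dstarOmega := codiff2 G f (domega G u) x in
  ricci G x X Y =
    (lambda p ^+ 2 * KN + laplacian G f lnl x + 'D_(mu x) lnl x)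
      * (ip (G x) X Y - theta X * theta Y)
    - 4^-1 * normI2 G u e x * ip (G x) X Y
    + 2^-1 * lie_metric G mu x X Y
    - muflat_dVlnl X * muflat_dVlnl Y
    - dVlnl X * dVlnl Y
    + 2 * symprod dUlnl theta X Y
    + symprod dstarOmega theta X Y.
Proof.
have [[phi_cont phi_smooth] phi_surj] := phi_submersion.
have [lambda_gt0 phi_conf] := phi_semiconformal.
have oV : open (W `&` phi @^-1` chart_dom d).
  apply: openI => //; apply: open_comp; last exact: chart_dom_open.
  by move=> q _; exact: phi_cont.
(* The formula concerns a neighbourhood of [chart_map c p], so the chart is shrunk to the points
   where [U] is given and whose images lie in the chart [d]. *)
pose D := Region (chart_image_open (c := chart_of c) oV).
pose D' := Region (chart_cod_open (c := chart_of d)).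
have DP (P : 'rV[R]_3 -> Prop) : (forall q, chart_dom c q -> W q ->
    chart_dom d (phi q) -> P (chart_map c q)) -> forall y, D y -> P y.
  by move=> HP _ [q [cq [Wq dq]] <-]; exact: HP.
have Dp : D (chart_map c p) by exists p.
have repE q : chart_dom c q -> rep phi c d (chart_map c q) = chart_map d (phi q).
  by move=> cq; rewrite /rep /= chart_mapK.
have D'P y : D y -> D' (rep phi c d y).
  by move: y; apply: DP => q cq Wq dq; rewrite repE//; exists (phi q).
pose Lam (y : 'rV[R]_3) : R := lambda (chart_inv c y).
have sD : smooth_on D (g c).
  by move=> s _ [q [cq _] <-]; apply: gram_smooth; exists q.
have sym_g y : D y -> (g c y)^T = g c y.
  by move: y; apply: DP => q cq _ _; exact: gram_sym.
have pos_g y : D y -> forall v, v != 0 -> 0 < ip (g c y) v v.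
  by move: y; apply: DP => q cq _ _; exact: gram_pos.
have sym_h z : D' z -> (h d z)^T = h d z by case=> q dq <-; exact: gram_sym.
have pos_h z : D' z -> forall v, v != 0 -> 0 < ip (h d z) v v.
  by case=> q dq <-; exact: gram_pos.
have s_rep : smooth_on D (rep phi c d).
  by move=> s _ [q [cq [_ dq]] <-]; apply: phi_smooth; exists q.
have surj y : D y -> forall w, exists v, 'd (rep phi c d) y v = w.
  by move: y; apply: DP => q cq _ dq; exact: (phi_surj q c d).
have Lam0 y : D y -> 0 < Lam y by move=> _; exact: lambda_gt0.
have conf y : D y -> forall v w, horizontal (g c y) ('d (rep phi c d) y) v ->
    horizontal (g c y) ('d (rep phi c d) y) w ->
    ip (h d (rep phi c d y)) ('d (rep phi c d) y v) ('d (rep phi c d) y w) =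
    Lam y ^+ 2 * ip (g c y) v w.
  move: y; apply: DP => q cq _ dq v w hv hw.
  by rewrite repE// /Lam chart_mapK//; exact: (phi_conf q c d).
have sU : smooth_on D (U c).
  by move=> s _ [q [cq [Wq _]] <-]; apply: (@vf_smooth _ _ _ _ U c); exists q.
have vertU y : D y -> 'd (rep phi c d) y (U c y) = 0.
  by move: y; apply: DP => q cq Wq dq; exact: (U_unit_vertical q c d Wq cq dq).1.
have unitU y : D y -> ip (g c y) (U c y) (U c y) = 1.
  by move: y; apply: DP => q cq Wq dq; exact: (U_unit_vertical q c d Wq cq dq).2.
have := @local_ricci_formula R D D' (g c) (h d) (rep phi c d) (U c) Lam sD sym_g pos_g
  (@gram_smooth _ _ _ h d) sym_h pos_h s_rep D'P surj Lam0 conf sU vertU unitU (chart_map c p) Dp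
  (fun y => ln (Lam y)) (fun y _ => erefl) f f_frame e e_frame e_horizontal X Y.
by rewrite /Lam chart_mapK// repE.
Qed.
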